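(* There is an absolute constant $C>0$ such that the following holds. Let $\mathcal{F}_1,\dots,\mathcal{F}_t$ be set systems on an $n$-point ground set $V$, and let $\mathcal{F}=\mathcal{F}_1\cup\cdots\cup\mathcal{F}_t$. Then \[ \operatorname{herdisc}\mathcal{F}\le C\sqrt{\log|\mathcal{F}|}\,\Bigl(\sum_{i=1}^t(\log|\mathcal{F}_i|)^2(\operatorname{herdisc}\mathcal{F}_i)^2\Bigr)^{1/2}. \]
   Context: For a set system $\mathcal{F}$ on ground set $V$, $\operatorname{disc}\mathcal{F}=\min_{x\in\{-1,1\}^V}\max_{F\in\mathcal{F}}\bigl|\sum_{v\in F}x_v\bigr|$, and $\operatorname{herdisc}\mathcal{F}=\max_{J\subseteq V}\operatorname{disc}(\mathcal{F}|_J)$, where $\mathcal{F}|_J=\{F\cap J:F\in\mathcal{F}\}$.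
   Formalization: Each set system F_i is assumed to have at least two members; without this the bound fails, e.g. for t=1 and F_1={{v}}, where herdisc F=1 but log|F_1|=0. *)

(* Defs.v *)
From HB Require Import structures.
From mathcomp Require Import all_boot all_order all_algebra.
From Stdlib Require Import Reals.
From mathcomp Require Import Rstruct.
Set Implicit Arguments. Unset Strict Implicit. Unset Printing Implicit Defensive.

(* Set systems on a finite ground set V are represented as {set {set V}}.
   A colouring x : V -> {-1,+1} is represented by x : {ffun V -> bool},
   true meaning +1 and false meaning -1. *)

Definition sgn (b : bool) : int := if b then Posz 1 else Negz 0.

Definition imbalance (V : finType) (x : {ffun V -> bool}) (S : {set V}) : nat :=
  absz (\big[+%R/Posz 0]_(v in S) sgn (x v)).

(* max_{S in F} |sum_{v in S} x_v| (0 when F is empty) *)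
Definition maxImb (V : finType) (F : {set {set V}}) (x : {ffun V -> bool}) : nat :=
  \max_(S in F) imbalance x S.

(* disc F = min over colourings of maxImb.  The initial value #|V| of the
   iterated minimum is harmless: every value maxImb F x is <= #|V|, and the
   type of colourings is always nonempty. *)
Definition disc (V : finType) (F : {set {set V}}) : nat :=
  \big[minn/#|V|]_(x : {ffun V -> bool}) maxImb F x.

Definition restrict (V : finType) (F : {set {set V}}) (J : {set V}) : {set {set V}} :=
  [set S :&: J | S in F].

Definition herdisc (V : finType) (F : {set {set V}}) : nat :=
  \max_(J : {set V}) disc (restrict F J).

(* Main.v *)
(** Call a factorization of the incidence matrix of [F] as the inner products
    [<b_S, c_v>] of cost [g] if [|b_S| <= 1] and [|c_v| <= g] throughout.

    Upper bound.  If such a factorization exists, a derandomized Gram-Schmidt walk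
    finds signs [x] for which [sum_v x_v c_v / g] is subgaussian on all the test
    vectors [b_S], so every imbalance is [O(g sqrt(log |F|))]; the same holds for
    every restriction of [F].

    Lower bound.  Hereditary discrepancy [h] forces every [k x k] minor of the
    incidence matrix to be at most [(2h+1)^k].  For row weights [p] and column
    weights [q] of total mass 1, Cauchy-Binet then bounds the product of any [k]
    singular values of [(sqrt (p_i q_j) A_ij)] by [(2h+1)^k / k!], hence the sum of
    all singular values by [O(h log |F|)].  By a minimax argument the weights can be
    dropped, and [F] has a factorization of cost [O(h log |F|)].

    Union.  Concatenating the vectors [c_v] of the systems [F_i] gives a factorization
    of the union whose squared cost is the sum of the squared costs. *)

From HB Require Import structures.
From mathcomp Require Import all_boot all_order all_fingroup all_algebra.
From mathcomp Require Import sesquilinear spectral complex.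
From mathcomp Require Import ring lra.
Require Import Defs.
Set Implicit Arguments. Unset Strict Implicit. Unset Printing Implicit Defensive.
Import Order.TTheory GRing.Theory Num.Theory.

(** * The exponential of a biased sign *)

Section Tilt.
Local Open Scope ring_scope.
(* Only these two properties of the exponential are used. *)
Context (R : realFieldType) (exp : R -> R).
Hypothesis exp_addr : forall x y, exp (x + y) = exp x * exp y.
Hypothesis exp_ge_1D : forall x, 1 + x <= exp x.
Implicit Types x y b s t : R.

Lemma exp0 : exp 0 = 1.
Proof.
have e0 : 0 < exp 0 by apply: lt_le_trans (exp_ge_1D 0); rewrite addr0.
by apply: (mulIf (lt0r_neq0 e0)); rewrite mul1r -exp_addr addr0.
Qed.

Lemma exp_mulN x : exp x * exp (- x) = 1.
Proof. by rewrite -exp_addr subrr exp0. Qed.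

Lemma exp_ge0 x : 0 <= exp x.
Proof.
have -> : x = x / 2 + x / 2 by lra.
by rewrite exp_addr -expr2 sqr_ge0.
Qed.

Lemma exp_mono x y : x <= y -> exp x <= exp y.
Proof.
move=> xy; have -> : y = x + (y - x) by ring.
have h := exp_ge_1D (y - x); rewrite exp_addr ler_peMr ?exp_ge0 //; lra.
Qed.

(** For [x] at most [1/2], [exp x <= 1 / (1 - x) <= 1 + x + 2 x^2]; beyond [1/2], [x <= 2 x^2] and
    monotonicity suffices. *)
Lemma exp_le_subgauss x : exp x <= x + exp (2 * x ^+ 2).
Proof.
have e2 := exp_ge_1D (2 * x ^+ 2).
have [x12|x12] := leP x (1 / 2).
  have e1 := exp_ge_1D (- x); have e3 := exp_mulN x; have e0 := exp_ge0 x.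
  have h : exp x * (1 - x) <= 1 by rewrite -[leRHS]e3 ler_wpM2l.
  have h2 : 1 <= (1 + x + 2 * x ^+ 2) * (1 - x).
    have : 0 <= x ^+ 2 * (1 - 2 * x) by rewrite mulr_ge0 ?sqr_ge0 //; lra.
    lra.
  have h3 : exp x <= 1 + x + 2 * x ^+ 2.
    have x1 : 0 < 1 - x by lra.
    by rewrite -(ler_pM2r x1) (le_trans h).
  lra.
have : exp x <= exp (2 * x ^+ 2) by apply: exp_mono; nra.
lra.
Qed.

(* The mean of [exp (b (X - y))] for a sign [X] with mean [y]. *)
Definition tilt y b : R :=
  ((1 + y) * exp ((1 - y) * b) + (1 - y) * exp (- (1 + y) * b)) / 2.

Lemma tiltN y b : tilt (- y) (- b) = tilt y b.
Proof.
rewrite /tilt.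
have -> : (1 - - y) * - b = - (1 + y) * b by ring.
have -> : - (1 + - y) * - b = (1 - y) * b by ring.
by rewrite opprK addrC.
Qed.

Lemma tilt0 y : tilt y 0 = 1.
Proof. by rewrite /tilt !mulr0 exp0; lra. Qed.

(** After multiplication by [exp (y * b)] the dependence on [y] is affine, which makes the potential
    of the walk affine in the step size. *)
Lemma exp_mul_tilt y b :
  exp (y * b) * tilt y b = ((1 + y) * exp b + (1 - y) * exp (- b)) / 2.
Proof.
rewrite /tilt mulrA mulrDr !(mulrCA (exp _)) -!exp_addr.
by congr ((_ * exp _ + _ * exp _) / _); ring.
Qed.

(** The derivative in [b] is a nonnegative multiple of [exp ((1 - y) b) - exp (- (1 + y) b)];
    tangent lines of [exp] at [s] replace differentiation. *)
Lemma tilt_le y s t : -1 <= y <= 1 -> 0 <= s <= t -> tilt y s <= tilt y t.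
Proof.
move=> /andP[y1 y2] /andP[s0 st]; rewrite /tilt ler_pM2r; last lra.
set a := 1 + y; set c := 1 - y.
have a0 : 0 <= a by rewrite /a; lra.
have c0 : 0 <= c by rewrite /c; lra.
have h1 : exp (c * s) * (1 + c * (t - s)) <= exp (c * t).
  have -> : c * t = c * s + c * (t - s) by ring.
  by rewrite exp_addr ler_wpM2l ?exp_ge0 ?exp_ge_1D.
have h2 : exp (- a * s) * (1 - a * (t - s)) <= exp (- a * t).
  have -> : - a * t = - a * s + - (a * (t - s)) by ring.
  by rewrite exp_addr ler_wpM2l ?exp_ge0 ?exp_ge_1D.
have h3 : exp (- a * s) <= exp (c * s).
  by apply: exp_mono; rewrite ler_wpM2r //; lra.
have h1' := ler_wpM2l a0 h1; have h2' := ler_wpM2l c0 h2.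
have h4 : 0 <= a * c * (t - s) * (exp (c * s) - exp (- a * s)).
  by rewrite !mulr_ge0 ?subr_ge0.
lra.
Qed.

(** With [h = t - s], both exponents move by at most [2 h], so [exp_le_subgauss] bounds each growth
    factor by a linear term plus [exp (8 h^2)]. The linear terms average to at most [4 s h], and
    [4 s h + 8 h^2 <= 8 (t^2 - s^2)]. *)
Lemma tilt_growth y s t : -1 <= y <= 1 -> 0 <= s <= t ->
  tilt y t <= tilt y s * exp (8 * (t ^+ 2 - s ^+ 2)).
Proof.
move=> /andP[y1 y2] /andP[s0 st].
set h := t - s; have h0 : 0 <= h by rewrite subr_ge0.
rewrite /tilt mulrAC ler_pM2r; last lra.
set a := 1 + y; set c := 1 - y.
have a0 : 0 <= a by rewrite /a; lra.
have c0 : 0 <= c by rewrite /c; lra.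
have ac : a + c = 2 by rewrite /a /c; ring.
set P := a * exp (c * s); set Q := c * exp (- a * s).
have P0 : 0 <= P by rewrite mulr_ge0 ?exp_ge0.
have Q0 : 0 <= Q by rewrite mulr_ge0 ?exp_ge0.
have -> : a * exp (c * t) = P * exp (c * h).
  by rewrite /P -mulrA -exp_addr; congr (_ * exp _); rewrite /h; ring.
have -> : c * exp (- a * t) = Q * exp (- a * h).
  by rewrite /Q -mulrA -exp_addr; congr (_ * exp _); rewrite /h; ring.
have main (z : R) : z ^+ 2 <= 4 -> exp (z * h) <= z * h + exp (8 * h ^+ 2).
  move=> z4; apply: (le_trans (exp_le_subgauss _)); rewrite lerD2l exp_mono //.
  by have := ler_wpM2r (sqr_ge0 h) z4; rewrite exprMn; lra.
have m1 : exp (c * h) <= c * h + exp (8 * h ^+ 2) by apply: main; nra.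
have m2 : exp (- a * h) <= - a * h + exp (8 * h ^+ 2) by apply: main; nra.
have mean : c * P - a * Q <= 4 * s * (P + Q).
  have e1 : exp (c * s) * (1 - 2 * s) <= exp (- a * s).
    have -> : - a * s = c * s + - (2 * s) by rewrite -ac; ring.
    by rewrite exp_addr ler_wpM2l ?exp_ge0 ?exp_ge_1D.
  have e2 := ler_wpM2l (mulr_ge0 a0 c0) e1.
  have c2 : c <= 2 by rewrite -ac lerDr.
  have e3 := ler_wpM2r (mulr_ge0 s0 P0) c2.
  have e4 : 0 <= s * Q by rewrite mulr_ge0.
  by move: e2 e3 e4; rewrite /P /Q; lra.
have e5 := exp_ge_1D (4 * s * h); have e6 := exp_ge_1D (8 * h ^+ 2).
have e7 : 4 * s * h + exp (8 * h ^+ 2) <= exp (8 * (t ^+ 2 - s ^+ 2)).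
  apply: (@le_trans _ _ (exp (4 * s * h + 8 * h ^+ 2))); last first.
    apply: exp_mono; have -> : t = s + h by rewrite /h; ring.
    have := mulr_ge0 s0 h0; lra.
  rewrite exp_addr; have sh0 := mulr_ge0 s0 h0; have hh := sqr_ge0 h.
  have := ler_wpM2r (exp_ge0 (8 * h ^+ 2)) e5.
  have : 0 <= (4 * s * h) * (exp (8 * h ^+ 2) - 1) by rewrite mulr_ge0 //; lra.
  lra.
have f1 := ler_wpM2l P0 m1; have f2 := ler_wpM2l Q0 m2.
have f3 := ler_wpM2r h0 mean.
have PQ0 : 0 <= P + Q by rewrite addr_ge0.
have f4 := ler_wpM2l PQ0 e7.
apply: le_trans f4; lra.
Qed.

Lemma tilt_ge0 y b : -1 <= y <= 1 -> 0 <= tilt y b.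
Proof.
move=> /andP[y1 y2]; rewrite /tilt mulr_ge0 ?invr_ge0 ?ler0n //.
rewrite addr_ge0 // mulr_ge0 ?exp_ge0 //; lra.
Qed.

Lemma tilt_ge1 y b : -1 <= y <= 1 -> 1 <= tilt y b.
Proof.
wlog b0 : y b / 0 <= b => [hwlog|] y1.
  have [|b0] := leP 0 b; first by move/hwlog; exact.
  by rewrite -tiltN hwlog //; lra.
by rewrite -(tilt0 y) tilt_le // lexx b0.
Qed.

Lemma tilt_le_exp y b : -1 <= y <= 1 -> tilt y b <= exp (8 * b ^+ 2).
Proof.
wlog b0 : y b / 0 <= b => [hwlog|] y1.
  have [|b0] := leP 0 b; first by move/hwlog; exact.
  by rewrite -tiltN -sqrrN hwlog //; lra.
have := @tilt_growth y 0 b y1; rewrite lexx b0 tilt0 mul1r expr0n subr0; exact.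
Qed.

(* Here [l] and [k] are the squared lengths of the current pivot residue and of
   the increment it receives when the alive set shrinks, [b] and [b'] are the
   pairings of the test vector with the residue before and after, and [e] is the
   loss in squared length of the projected test vector. *)
Lemma tilt_shift y b b' l k e : -1 <= y <= 1 ->
  0 <= l -> 0 <= k -> l + k <= 1 -> 0 <= e ->
  (l = 0 -> b = 0) -> (k = 0 -> b' = b) ->
  (k * b + l * (b - b')) ^+ 2 <= e * (k * l * (k + l)) ->
  tilt y b' <= tilt y b * exp (8 * (e + b' ^+ 2 - b ^+ 2)).
Proof.
wlog b0 : y b b' / 0 <= b => [hwlog|] y1 l0 k0 lk e0 lb kb he.
  have [|b0] := leP 0 b; first by move/hwlog; apply.
  rewrite -tiltN -(tiltN y b) -(sqrrN b) -(sqrrN b'); apply: hwlog => //.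
  - lra.
  - lra.
  - by move=> /lb ->; rewrite oppr0.
  - by move=> /kb ->.
  - have -> : k * - b + l * (- b - - b') = - (k * b + l * (b - b')) by ring.
    by rewrite sqrrN.
have t0 := tilt_ge0 b y1.
have [bb'|b'b] := leP b b'.
  apply: (le_trans (tilt_growth y1 (t := b') (s := b) _)); first by rewrite b0.
  by rewrite ler_wpM2l // exp_mono //; lra.
have [l0'|ln] := eqVneq l 0.
  have bE := lb l0'; rewrite bE tilt0 mul1r.
  apply: (le_trans (tilt_le_exp _ y1)); apply: exp_mono; lra.
have kn : k != 0 by apply/eqP => /kb; lra.
have lp : 0 < l by rewrite lt_neqAle eq_sym ln.
have kp : 0 < k by rewrite lt_neqAle eq_sym kn.
have klp : 0 < k * l by rewrite mulr_gt0.
have he' : (k * b + l * (b - b')) ^+ 2 <= e * (k * l).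
  apply: (le_trans he); rewrite ler_wpM2l // ger_pMr //; lra.
(* AM-GM and division by [k l] give [4 b (b - b') <= e]. For [b' >= 0] this yields
   [b^2 - b'^2 <= e], and the tilt is monotone; for [b' < 0] it yields [b^2 <= e], and [tilt_le_exp]
   suffices. *)
have amgm (u v : R) : 4 * (u * v) <= (u + v) ^+ 2 by have := sqr_ge0 (u - v); lra.
have h4 := le_trans (amgm _ _) he'.
have [b'0|b'0] := leP 0 b'.
  have h5 : b ^+ 2 - b' ^+ 2 <= e.
    have h6 : 4 * (b * (b - b')) <= e by rewrite -(ler_pM2r klp); lra.
    have : 0 <= (b - b') * (b - b') by rewrite mulr_ge0 //; lra.
    have : 0 <= (b - b') * b' by rewrite mulr_ge0 //; lra.
    have : 0 <= (b - b') * b by rewrite mulr_ge0 //; lra.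
    lra.
  apply: (le_trans (tilt_le y1 (t := b) (s := b') _)); first by rewrite b'0 ltW.
  rewrite ler_peMr //; have := exp_ge_1D (8 * (e + b' ^+ 2 - b ^+ 2)); lra.
have h5 : b ^+ 2 <= e.
  have h6 : 4 * (b * (b - b')) <= e by rewrite -(ler_pM2r klp); lra.
  have : 0 <= b * - b' by rewrite mulr_ge0 //; lra.
  have := sqr_ge0 b; lra.
apply: (le_trans (tilt_le_exp _ y1)).
apply: (@le_trans _ _ (1 * exp (8 * (e + b' ^+ 2 - b ^+ 2)))).
  by rewrite mul1r; apply: exp_mono; lra.
by rewrite ler_wpM2r ?exp_ge0 ?tilt_ge1.
Qed.
End Tilt.

(** * Orthogonal projections for a semidefinite form *)

Section Projection.
Local Open Scope ring_scope.
Context (R : realFieldType) (E : lmodType R) (dot : E -> E -> R).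
Hypothesis dotC : forall u v, dot u v = dot v u.
Hypothesis dotDl : forall u v w, dot (u + v) w = dot u w + dot v w.
Hypothesis dotZl : forall a u v, dot (a *: u) v = a * dot u v.
Hypothesis dot_ge0 : forall u, 0 <= dot u u.

Lemma dotDr u v w : dot w (u + v) = dot w u + dot w v.
Proof. by rewrite dotC dotDl !(dotC w). Qed.

Lemma dotZr a u v : dot v (a *: u) = a * dot v u.
Proof. by rewrite dotC dotZl dotC. Qed.

Lemma dot0l v : dot 0 v = 0.
Proof. by rewrite -(scale0r 0) dotZl mul0r. Qed.

Lemma dot0r v : dot v 0 = 0.
Proof. by rewrite dotC dot0l. Qed.

Lemma dotNl u v : dot (- u) v = - dot u v.
Proof. by rewrite -scaleN1r dotZl mulN1r. Qed.

Lemma dotNr u v : dot v (- u) = - dot v u.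
Proof. by rewrite dotC dotNl dotC. Qed.

Lemma dotBl u v w : dot (u - v) w = dot u w - dot v w.
Proof. by rewrite dotDl dotNl. Qed.

Lemma dotBr u v w : dot w (u - v) = dot w u - dot w v.
Proof. by rewrite dotDr dotNr. Qed.

Lemma dot_cs u v : dot u v ^+ 2 <= dot u u * dot v v.
Proof.
have expand s : dot (u + s *: v) (u + s *: v) =
    dot u u + 2 * s * dot u v + s ^+ 2 * dot v v.
  by rewrite !(dotDl, dotDr, dotZl, dotZr) (dotC v u); ring.
have [v0|vn] := eqVneq (dot v v) 0.
  rewrite v0 mulr0; have [->|uvn] := eqVneq (dot u v) 0; first by rewrite expr0n.
  (* This multiple of the null vector [v] would produce a vector of squared length [-1]. *)
  have := dot_ge0 (u + (- (dot u u + 1) / (2 * dot u v)) *: v).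
  rewrite expand v0 mulr0 addr0.
  have -> : 2 * (- (dot u u + 1) / (2 * dot u v)) * dot u v = - (dot u u + 1).
    by field.
  lra.
have vp : 0 < dot v v by rewrite lt_neqAle eq_sym vn dot_ge0.
have := dot_ge0 (u + (- dot u v / dot v v) *: v); rewrite expand.
have -> : dot u u + 2 * (- dot u v / dot v v) * dot u v +
   (- dot u v / dot v v) ^+ 2 * dot v v
   = (dot u u * dot v v - dot u v ^+ 2) / dot v v by field.
by rewrite pmulr_lge0 ?invr_gt0 // subr_ge0.
Qed.

Lemma dot_null u v : dot v v = 0 -> dot u v = 0.
Proof.
move=> v0; have := dot_cs u v; rewrite v0 mulr0 => h.
by apply/eqP; rewrite -sqrf_eq0 eq_le h sqr_ge0.
Qed.

Context (V : finType) (u : V -> E).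
Implicit Types A B : {set V}.

(* When [dot r r = 0] the quotient is [0] and [r] is orthogonal to everything. *)
Fixpoint projs (s : seq V) (w : E) : E :=
  if s is i :: s' then
    let r := u i - projs s' (u i) in projs s' w + (dot w r / dot r r) *: r
  else 0.

(** Membership in the span of the [u i] up to null vectors, put in dual form because [dot] may be
    degenerate. *)
Definition spanned (A : {set V}) (x : E) :=
  forall y, (forall i, i \in A -> dot y (u i) = 0) -> dot y x = 0.

Lemma projs_combination s w : uniq s ->
  exists c : V -> R, (forall i, i \notin s -> c i = 0) /\
    projs s w = \sum_i c i *: u i.
Proof.
elim: s w => [|i s ihs] w /= => [_|/andP[is_ us]].
  by exists (fun=> 0); split=> //; rewrite big1 // => i _; rewrite scale0r.
have [c [c0 ->]] := ihs w us; have [d [d0 ->]] := ihs (u i) us.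
set a := (X in X *: _).
exists (fun j => c j + a * ((j == i)%:R - d j)); split.
  move=> j; rewrite inE negb_or => /andP[/negPf-> js].
  by rewrite c0 // d0 // subrr mulr0 addr0.
under [RHS]eq_bigr do rewrite scalerDl -scalerA scalerBl.
rewrite big_split /= -scaler_sumr sumrB; congr (_ + _ *: (_ - _)).
rewrite (bigD1 i) //= eqxx scale1r big1 ?addr0 // => j /negPf->.
by rewrite scale0r.
Qed.

Lemma dot_projs s w y : (forall i, i \in s -> dot y (u i) = 0) ->
  dot y (projs s w) = 0.
Proof.
elim: s w => [|i s ihs] w ys /=; first by rewrite dot0r.
have ys' j : j \in s -> dot y (u j) = 0 by move=> js; rewrite ys // inE js orbT.
by rewrite dotDr dotZr (dotBr _ _ y) !ihs // ys ?mem_head // subrr mulr0 addr0.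
Qed.

Lemma projs_orth s w i : i \in s -> dot (w - projs s w) (u i) = 0.
Proof.
elim: s w i => [|j s ihs] w i //=; set r := u j - projs s (u j).
have rs k : k \in s -> dot r (u k) = 0 by move=> ks; apply: ihs.
have rj : dot r (u j) = dot r r by rewrite [in RHS]dotBr (dot_projs _ rs) subr0.
rewrite opprD addrA dotBl dotZl inE => /predU1P[->|is_]; last first.
  by rewrite ihs // rs // mulr0 subr0.
rewrite rj.
have -> : dot (w - projs s w) (u j) = dot w r.
  rewrite -[u j](subrK (projs s (u j))) -/r dotDr (dot_projs (u j)).
    by rewrite addr0 dotBl (dotC (projs s w)) (dot_projs w rs) subr0.
  by move=> k ks; apply: ihs.
have [r0|rn] := eqVneq (dot r r) 0; first by rewrite dot_null // r0; ring.
by rewrite divfK // subrr.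
Qed.

Definition proj (A : {set V}) (w : E) : E := projs (enum A) w.

Definition proj_norm2 (A : {set V}) (w : E) : R := dot (proj A w) (proj A w).

Definition residue (A : {set V}) (w : E) : E := w - proj A w.

Lemma proj_spanned A w : spanned A (proj A w).
Proof. by move=> y yA; apply: dot_projs => i; rewrite mem_enum; apply: yA. Qed.

Lemma residue_orth A w i : i \in A -> dot (residue A w) (u i) = 0.
Proof. by move=> iA; apply: projs_orth; rewrite mem_enum. Qed.

Lemma dot_residue A w x : spanned A x -> dot (residue A w) x = 0.
Proof. by move=> Ax; apply: Ax => i; exact: residue_orth. Qed.

Lemma spannedB A x y : spanned A x -> spanned A y -> spanned A (x - y).
Proof. by move=> Ax Ay z zA; rewrite dotBr Ax // Ay // subrr. Qed.

Lemma spannedZ A a x : spanned A x -> spanned A (a *: x).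
Proof. by move=> Ax z zA; rewrite dotZr Ax // mulr0. Qed.

Lemma spanned_gen A i : i \in A -> spanned A (u i).
Proof. by move=> iA z; apply. Qed.

Lemma spanned_sub A B x : A \subset B -> spanned A x -> spanned B x.
Proof. by move=> /subsetP AB Ax z zB; apply: Ax => i /AB; exact: zB. Qed.

Lemma dot_proj A w x : spanned A x -> dot (proj A w) x = dot w x.
Proof.
by move=> /(dot_residue w) /eqP; rewrite dotBl subr_eq0 eq_sym => /eqP.
Qed.

Lemma proj_norm2E A w : proj_norm2 A w = dot w w - dot (residue A w) (residue A w).
Proof.
have h := dot_proj w (@proj_spanned A w).
by rewrite /proj_norm2 /residue dotBl !dotBr (dotC (proj A w) w) -h; ring.
Qed.

Lemma proj_norm2_le A w : proj_norm2 A w <= dot w w.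
Proof. by rewrite proj_norm2E gerBl dot_ge0. Qed.

Lemma residue_le A w : dot (residue A w) (residue A w) <= dot w w.
Proof. by have := proj_norm2E A w; have := dot_ge0 (proj A w); rewrite /proj_norm2; lra. Qed.

Lemma proj_norm2B A B w : A \subset B ->
  dot (proj B w - proj A w) (proj B w - proj A w) = proj_norm2 B w - proj_norm2 A w.
Proof.
move=> AB; have sA := @proj_spanned A w.
rewrite dotBl !dotBr (dotC (proj A w) (proj B w)).
rewrite (dot_proj w (spanned_sub AB sA)) -(dot_proj w sA) /proj_norm2; ring.
Qed.

Lemma proj_norm2_mono A B w : A \subset B -> proj_norm2 A w <= proj_norm2 B w.
Proof. by move=> AB; rewrite -subr_ge0 -proj_norm2B. Qed.

(** Such a [v] pairs with [w] exactly as with [proj B w - proj A w]; Cauchy-Schwarz finishes. *)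
Lemma dot_gap A B w v : A \subset B -> spanned B v ->
  (forall i, i \in A -> dot v (u i) = 0) ->
  dot w v ^+ 2 <= (proj_norm2 B w - proj_norm2 A w) * dot v v.
Proof.
move=> AB Bv vA; rewrite -proj_norm2B //; apply: le_trans (dot_cs _ _).
by rewrite dotBl dot_proj // (dotC (proj A w)) (proj_spanned w vA) subr0.
Qed.

Definition pivot (A : {set V}) (p : V) : E := residue (A :\ p) (u p).

Lemma pivot_spanned (A : {set V}) p : p \in A -> spanned A (pivot A p).
Proof.
move=> pA; apply: spannedB; first exact: spanned_gen.
by apply: spanned_sub (@proj_spanned _ _); rewrite subD1set.
Qed.

Lemma pivot_combination (A : {set V}) p : p \in A ->
  exists c : V -> R, [/\ c p = 1, forall i, i \notin A -> c i = 0 &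
    pivot A p = \sum_i c i *: u i].
Proof.
move=> pA; have [c [c0 cE]] := projs_combination (u p) (enum_uniq (A :\ p)).
exists (fun i => (i == p)%:R - c i); split.
- by rewrite eqxx c0 ?subr0 // mem_enum !inE eqxx.
- move=> i iA; rewrite c0 ?mem_enum ?inE ?(negPf iA) ?andbF //.
  by rewrite subr0; case: eqP iA => // ->; rewrite pA.
rewrite /pivot /residue /proj cE.
under [RHS]eq_bigr do rewrite scalerBl.
rewrite sumrB; congr (_ - _).
rewrite (bigD1 p) //= eqxx scale1r big1 ?addr0 // => j /negPf->.
by rewrite scale0r.
Qed.

(** When the pivot itself freezes, the potential loses its term in the squared pairing; the fall in
    projected length compensates. *)
Lemma dot_pivot_drop (A : {set V}) p w : p \in A -> dot (u p) (u p) <= 1 ->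
  dot w (pivot A p) ^+ 2 <= proj_norm2 A w - proj_norm2 (A :\ p) w.
Proof.
move=> pA up; have sub := subD1set A p.
apply: le_trans (dot_gap w sub (pivot_spanned pA) _) _.
  by move=> i; exact: residue_orth.
rewrite ler_piMr ?subr_ge0 ?proj_norm2_mono //.
exact: le_trans (residue_le _ _) up.
Qed.

(** Supplies the hypotheses of [tilt_shift]. The old residue and its increment are orthogonal, so
    [l + k] is the squared length of the new residue. *)
Lemma pivot_shift (A B : {set V}) p w : A \subset B -> p \in A ->
  dot (u p) (u p) <= 1 ->
  exists l k, [/\ 0 <= l, 0 <= k, l + k <= 1,
    (l = 0 -> dot w (pivot B p) = 0) /\
    (k = 0 -> dot w (pivot A p) = dot w (pivot B p)) &
    (k * dot w (pivot B p) + l * (dot w (pivot B p) - dot w (pivot A p))) ^+ 2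
    <= (proj_norm2 B w - proj_norm2 A w) * (k * l * (k + l))].
Proof.
move=> AB pA up; have pB := subsetP AB p pA.
set a := pivot A p; set b := pivot B p; set r := a - b.
have AB' : A :\ p \subset B :\ p by exact: setSD.
have sr : spanned (B :\ p) r.
  rewrite /r /a /b /pivot /residue opprB addrC addrA subrK.
  by apply: spannedB; [|apply: spanned_sub AB' _]; exact: proj_spanned.
have br : dot b r = 0 by exact: dot_residue.
have aE : a = b + r by rewrite /r addrC subrK.
have aA i : i \in A :\ p -> dot a (u i) = 0 by exact: residue_orth.
have bA i : i \in A :\ p -> dot b (u i) = 0.
  by move=> /(subsetP AB'); exact: residue_orth.
have rA i : i \in A :\ p -> dot r (u i) = 0.
  by move=> iA; rewrite /r dotBl aA // bA // subrr.
have wr : dot w r = dot w a - dot w b by rewrite /r dotBr.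
have aa1 : dot a a <= 1 by exact: le_trans (residue_le _ _) up.
have ap x : (forall i, i \in A :\ p -> dot x (u i) = 0) -> dot x (u p) = dot x a.
  by move=> xA; rewrite /a /pivot /residue dotBr (proj_spanned (u p) xA) subr0.
have sb : spanned B b by exact: pivot_spanned.
have {}sr : spanned B r by apply: spanned_sub sr; rewrite subD1set.
clearbody r b a.
have rb : dot r b = 0 by rewrite dotC.
rewrite {}aE in wr aa1 ap *; move: aa1.
rewrite !(dotDl, dotDr) br rb addr0 add0r => aa1.
exists (dot b b), (dot r r); split; rewrite ?dot_ge0 //.
- by split=> [/(dot_null w)->//|/(dot_null w)->]; rewrite addr0.
(* [v] is the combination of [b] and [r] orthogonal to [b + r], hence to every vector indexed by
   [A]; its squared length is [k l (k + l)]. *)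
set l := dot b b; set k := dot r r; set v := k *: b - l *: r.
have -> : k * dot w b + l * (dot w b - (dot w b + dot w r)) = dot w v.
  by rewrite /v dotBr !dotZr; ring.
have -> : k * l * (k + l) = dot v v.
  by rewrite /v !(dotBl, dotBr, dotZl, dotZr) br rb -/k -/l; ring.
have vA' i : i \in A :\ p -> dot v (u i) = 0.
  by move=> iA; rewrite /v dotBl !dotZl rA // bA //; ring.
apply: dot_gap => // [|i iA].
  by apply: spannedB; exact: spannedZ.
have [->|ip] := eqVneq i p; last by apply: vA'; rewrite !inE ip.
by rewrite ap // /v dotBl !dotZl !dotDr br rb -/k -/l; ring.
Qed.
End Projection.

(** * The Gram-Schmidt walk *)

Section Walk.
Local Open Scope ring_scope.
Context (R : realFieldType) (exp : R -> R).
Hypothesis exp_addr : forall x y, exp (x + y) = exp x * exp y.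
Hypothesis exp_ge_1D : forall x, 1 + x <= exp x.
Context (E : lmodType R) (dot : E -> E -> R).
Hypothesis dotC : forall u v, dot u v = dot v u.
Hypothesis dotDl : forall u v w, dot (u + v) w = dot u w + dot v w.
Hypothesis dotZl : forall a u v, dot (a *: u) v = a * dot u v.
Hypothesis dot_ge0 : forall u, 0 <= dot u u.
Context (V : finType) (u : V -> E).
Implicit Types A B : {set V}.
Hypothesis u_le1 : forall i, dot (u i) (u i) <= 1.
Context (I : finType) (w : I -> E).

Local Notation pivot := (pivot dot u).
Local Notation proj_norm2 := (proj_norm2 dot u).

Lemma first_hit (A : {set V}) (y c : V -> R) p :
  (forall i, -1 <= y i <= 1) -> c p != 0 -> (forall i, i \notin A -> c i = 0) ->
  exists i0 d, [/\ i0 \in A, 0 <= d, forall i, -1 <= y i + d * c i <= 1 &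
    y i0 + d * c i0 = 1 \/ y i0 + d * c i0 = -1].
Proof.
move=> y1 cp cA.
(* The time at which coordinate [i], moving at speed [c i], reaches the sign of [c i]. *)
pose t i := (1 - Num.sg (c i) * y i) / `|c i|.
have t0 i : c i != 0 -> 0 <= 1 - Num.sg (c i) * y i.
  move: (y1 i) => /andP[h1 h2]; case: sgrP => // _ _; lra.
case: (@arg_minP _ _ _ p (fun i => c i != 0) t cp) => i0 ci0 min0.
exists i0, (t i0).
have t0p : 0 <= t i0 by rewrite /t divr_ge0 ?t0.
split=> //.
- by apply: contraR ci0 => /cA ->.
- move=> i; move: (y1 i) => /andP[h1 h2].
  have [->|ci] := eqVneq (c i) 0; first by rewrite mulr0 addr0 y1.
  have := min0 i ci; rewrite {2}/t ler_pdivlMr ?normr_gt0 //.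
  case: (sgrP (c i)) => [/eqP|cpos|cneg]; first by rewrite (negPf ci).
    move=> h; have := mulr_ge0 t0p (ltW cpos); lra.
  move=> h.
  have : 0 <= t i0 * - c i by rewrite mulr_ge0 // oppr_ge0 ltW.
  lra.
rewrite /t; case: (sgrP (c i0)) => [/eqP|cpos|cneg]; first by rewrite (negPf ci0).
  by left; rewrite divfK //; lra.
by right; rewrite invrN mulrN mulNr divfK //; lra.
Qed.

(* The walk keeps a fractional colouring [y] and a set [A] of alive coordinates
   containing the pivot [p]; moving [y] along the coefficients of [pivot A p] changes
   this potential affinely, so one of the two directions does not increase it. *)
Definition potential (A : {set V}) p (y : V -> R) i :=
  exp (dot (w i) (\sum_v y v *: u v)) *
  (tilt exp (y p) (dot (w i) (pivot A p)) *
   exp (8 * (proj_norm2 A (w i) - dot (w i) (pivot A p) ^+ 2))).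

(** The first factor gains [exp (d * b)], which [exp_mul_tilt] absorbs into an expression affine in
    [y p + d]. *)
Lemma potential_affine (A : {set V}) p (y c : V -> R) i :
  c p = 1 -> pivot A p = \sum_v c v *: u v ->
  exists a, forall d,
  potential A p (fun v => y v + d * c v) i = potential A p y i + d * a.
Proof.
move=> cp pE; set b := dot (w i) (pivot A p).
set z := dot (w i) (\sum_v y v *: u v).
set G := exp (8 * (proj_norm2 A (w i) - b ^+ 2)).
have key d : potential A p (fun v => y v + d * c v) i =
    exp z * exp (- (y p * b)) *
    (((1 + (y p + d)) * exp b + (1 - (y p + d)) * exp (- b)) / 2) * G.
  rewrite /potential -/b -/G cp mulr1 -exp_mul_tilt //.
  have -> : dot (w i) (\sum_v (y v + d * c v) *: u v) =
      z + - (y p * b) + (y p + d) * b.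
    under eq_bigr do rewrite scalerDl -scalerA.
    rewrite big_split /= -scaler_sumr -pE (dotDr dotC dotDl) (dotZr dotC dotZl).
    by rewrite -/b -/z; ring.
  by rewrite !exp_addr; ring.
exists (exp z * exp (- (y p * b)) * ((exp b - exp (- b)) / 2) * G) => d.
have -> : potential A p y i = potential A p (fun v => y v + 0 * c v) i.
  rewrite /potential mul0r addr0; congr (exp (dot _ _) * _).
  by apply: eq_bigr => v _; rewrite mul0r addr0.
by rewrite !key; ring.
Qed.

Lemma tilt_pm1 (y b : R) : y = 1 \/ y = -1 -> tilt exp y b = 1.
Proof.
case=> ->; rewrite /tilt.
  by rewrite subrr !mul0r (exp0 exp_addr exp_ge_1D); lra.
by rewrite addrN oppr0 !mul0r (exp0 exp_addr exp_ge_1D); lra.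
Qed.

(** Induction on the number of alive coordinates: move in a direction of nonpositive total slope
    until a coordinate reaches a sign, and remove it. [tilt_shift] covers the loss of a non-pivot
    coordinate; [dot_pivot_drop] covers the loss of the pivot. *)
Lemma walk_exists n (A : {set V}) (y : V -> R) p : (#|A| <= n)%N -> p \in A ->
  (forall v, -1 <= y v <= 1) -> (forall v, v \notin A -> y v = 1 \/ y v = -1) ->
  exists x : V -> bool,
    \sum_i exp (dot (w i) (\sum_v (-1) ^+ x v *: u v)) <=
    \sum_i potential A p y i.
Proof.
have expge0 := exp_ge0 exp_addr.
have expmono := exp_mono exp_addr exp_ge_1D.
elim: n A y p => [|n ihn] A y p An pA y1 yA.
  by move: An; rewrite leqn0 cards_eq0 => /eqP A0; rewrite A0 inE in pA.
have [c [cp c0 pE]] := pivot_combination dot u pA.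
have [a aE] : exists a, forall i d,
    potential A p (fun v => y v + d * c v) i = potential A p y i + d * a i.
  have /fin_all_exists[a aE] := fun i => potential_affine y i cp pE.
  by exists a.
have [s [s1 sa]] : exists s, (s = 1 \/ s = -1) /\ s * \sum_i a i <= 0.
  have [h|h] := leP (\sum_i a i) 0; first by exists 1; rewrite mul1r; auto.
  by exists (-1); rewrite mulN1r oppr_le0 ltW; auto.
have sn : s != 0 by case: s1 => ->; rewrite ?oppr_eq0 oner_eq0.
have [||i0 [d [i0A d0 y'1 hit]]] := @first_hit A y (fun v => s * c v) p y1.
- by rewrite cp mulr1.
- by move=> i /c0 ->; rewrite mulr0.
pose y' v := y v + d * s * c v.
have y'E v : y v + d * (s * c v) = y' v by rewrite /y' mulrA.
have {}y'1 v : -1 <= y' v <= 1 by rewrite -y'E.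
rewrite y'E in hit.
have step : \sum_i potential A p y' i <= \sum_i potential A p y i.
  under eq_bigr do rewrite aE.
  rewrite big_split /= -mulr_sumr gerDl -mulrA; exact: mulr_ge0_le0.
have y'A v : v \notin A :\ i0 -> y' v = 1 \/ y' v = -1.
  rewrite !inE negb_and negbK => /predU1P[->//|vA].
  by rewrite /y' c0 // mulr0 addr0; exact: yA.
have cardA' : (#|A :\ i0| <= n)%N.
  by move: An; rewrite (cardsD1 i0) i0A add1n ltnS.
have sub := subD1set A i0.
have [i0p|i0p] := eqVneq i0 p; last first.
  have pA' : p \in A :\ i0 by rewrite !inE eq_sym i0p.
  have [x xE] := ihn _ _ _ cardA' pA' y'1 y'A.
  exists x; apply: (le_trans xE); apply: le_trans step.
  apply: ler_sum => i _; rewrite /potential ler_wpM2l ?expge0 //.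
  have [l [k [l0 k0 lk [lb kb] ineq]]] :=
    pivot_shift dotC dotDl dotZl dot_ge0 (w i) sub pA' (u_le1 p).
  have e0 : 0 <= proj_norm2 A (w i) - proj_norm2 (A :\ i0) (w i).
    by rewrite subr_ge0 proj_norm2_mono.
  have := tilt_shift exp_addr exp_ge_1D (y'1 p) l0 k0 lk e0 lb kb ineq.
  set B' := dot _ (pivot (_ :\ _) _); set B := dot _ (pivot A p) => h.
  apply: (le_trans (ler_wpM2r (expge0 _) h)).
  rewrite -mulrA -exp_addr ler_wpM2l ?(tilt_ge0 exp_addr) //.
  by apply: expmono; lra.
rewrite i0p in cardA' y'A hit sub.
have bound i : exp (dot (w i) (\sum_v y' v *: u v)) * exp (8 * proj_norm2 (A :\ p) (w i))
    <= potential A p y' i.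
  rewrite /potential ler_wpM2l // tilt_pm1 // mul1r expmono //.
  have := dot_pivot_drop dotC dotDl dotZl dot_ge0 (w i) pA (u_le1 p); lra.
have [A0|[q qA]] := set_0Vmem (A :\ p).
  (* Nothing is alive any more, so [y'] is itself a colouring, with [true] encoding [-1]. *)
  exists (fun v => y' v == -1); apply: le_trans step; apply: ler_sum => i _.
  apply: le_trans (bound i).
  have -> : \sum_v (-1) ^+ (y' v == -1) *: u v = \sum_v y' v *: u v.
    apply: eq_bigr => v _; congr (_ *: _).
    have /y'A : v \notin A :\ p by rewrite A0 inE.
    case=> ->; last by rewrite eqxx.
    by case: eqP => // h; exfalso; move: h; lra.
  rewrite ler_peMr //; apply: le_trans (exp_ge_1D _).
  by rewrite lerDl mulr_ge0 // dot_ge0.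
have [x xE] := ihn _ _ _ cardA' qA y'1 y'A.
exists x; apply: (le_trans xE); apply: le_trans step; apply: ler_sum => i _.
apply: le_trans (bound i); rewrite /potential ler_wpM2l //.
(* Any alive coordinate can be the new pivot: its tilt is at most [exp (8 b^2)], which the term
   [- b^2] in the potential cancels. *)
apply: (le_trans (ler_wpM2r (expge0 _) (tilt_le_exp exp_addr exp_ge_1D _ (y'1 q)))).
by rewrite -exp_addr; apply: expmono; lra.
Qed.

(** The walk starts at [y = 0] with everything alive and an arbitrary pivot. *)
Theorem subgaussian_signs : exists x : V -> bool,
  \sum_i exp (dot (w i) (\sum_v (-1) ^+ x v *: u v)) <=
  \sum_i exp (8 * dot (w i) (w i)).
Proof.
have expmono := exp_mono exp_addr exp_ge_1D.
have expge0 := exp_ge0 exp_addr.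
have [V0|[p _]] := set_0Vmem [set: V].
  exists (fun=> true); apply: ler_sum => i _.
  rewrite big1 => [|v _]; last by have := in_setT v; rewrite V0 inE.
  by rewrite (dot0r dotC dotZl) expmono // mulr_ge0.
have h0 : -1 <= (0 : R) <= 1 by lra.
have hT v : v \notin [set: V] -> (0 : R) = 1 \/ (0 : R) = -1 by rewrite inE.
have [x xE] := walk_exists (eq_leq (cardsT V)) (in_setT p) (fun=> h0) hT.
exists x; apply: (le_trans xE); apply: ler_sum => i _.
rewrite /potential big1 => [|v _]; last by rewrite scale0r.
rewrite (dot0r dotC dotZl) (exp0 exp_addr exp_ge_1D) mul1r.
apply: (le_trans (ler_wpM2r (expge0 _) (tilt_le_exp exp_addr exp_ge_1D _ h0))).
rewrite -exp_addr; apply: expmono.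
have := proj_norm2_le dotC dotDl dotZl dot_ge0 u setT (w i); lra.
Qed.
End Walk.

(** * Minimax *)

Section Minimax.
Local Open Scope ring_scope.
Context (R : archiRealFieldType) (I : finType) (K : (I -> R) -> Prop) (g : R).
Hypothesis g_gt0 : 0 < g.
Hypothesis K_convex : forall z z' (s : R), 0 <= s <= 1 -> K z -> K z' ->
  K (fun i => (1 - s) * z i + s * z' i).
Hypothesis K_ge0 : forall z i, K z -> 0 <= z i.
Hypothesis K_response : forall w : I -> R, (forall i, 0 < w i) ->
  exists z, K z /\ \sum_i w i * z i <= g * \sum_i w i.

Let pos (x : R) : R := Num.max 0 x.
Let excess (z : I -> R) : R := \sum_i pos (z i - g) ^+ 2.

Let pos_ge0 x : 0 <= pos x. Proof. by rewrite /pos le_max lexx. Qed.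

Let excess_ge0 z : 0 <= excess z.
Proof. by apply: sumr_ge0 => i _; exact: sqr_ge0. Qed.

Let excess_segment z z' s : 0 <= s <= 1 ->
  excess (fun i => (1 - s) * z i + s * z' i) <=
  (1 - s) ^+ 2 * excess z + 2 * s * (1 - s) * \sum_i pos (z i - g) * (z' i - g)
  + s ^+ 2 * \sum_i (z' i - g) ^+ 2.
Proof.
move=> /andP[s0 s1]; rewrite /excess !mulr_sumr -!big_split /=.
apply: ler_sum => i _; set d := z i - g; set d' := z' i - g.
have -> : (1 - s) * z i + s * z' i - g = (1 - s) * d + s * d'.
  by rewrite /d /d'; ring.
have -> : (1 - s) ^+ 2 * pos d ^+ 2 + 2 * s * (1 - s) * (pos d * d') + s ^+ 2 * d' ^+ 2
  = ((1 - s) * pos d + s * d') ^+ 2 by ring.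
have le_pos : (1 - s) * d + s * d' <= (1 - s) * pos d + s * d'.
  by rewrite lerD2r ler_wpM2l ?subr_ge0 // /pos le_max lexx orbT.
rewrite {1}/pos; case: (leP 0 ((1 - s) * d + s * d')) => h; last first.
  by rewrite expr0n sqr_ge0.
by rewrite lerXn2r // nnegrE ?(le_trans h).
Qed.

(* Moving towards the best response to the weights [(z - g)_+ + dl] decreases the
   excess; the term [dl] keeps the responses bounded. *)
Let descent (M : R) : exists2 eta, 0 < eta & forall z, K z ->
  excess z <= M -> g ^+ 2 <= excess z ->
  exists z', K z' /\ excess z' <= excess z - eta.
Proof.
set N : R := #|I|%:R; have N0 : 0 <= N by rewrite ler0n.
(* Small enough that the extra weights change the cross term by at most [g^2 / 2]. *)
set dl := g / (2 * (N + 1)).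
have dl0 : 0 < dl by rewrite divr_gt0 // mulr_gt0 //; lra.
have dlN : dl * N <= g / 2.
  have : dl * (2 * (N + 1)) = g by rewrite /dl divfK // gt_eqF // mulr_gt0 //; lra.
  lra.
clearbody dl; have [M0|M0] := ltP M 0.
  by exists 1 => // z _ zM _; have := excess_ge0 z; lra.
(* [Z] bounds every coordinate of a response: its weight is at least [dl], and the total weight is
   at most [N + M + N dl]. *)
set Z := g * (N + M + N * dl) / dl.
have Z0 : 0 <= Z.
  have h : 0 <= N + M + N * dl by have := mulr_ge0 N0 (ltW dl0); lra.
  exact: divr_ge0 (mulr_ge0 (ltW g_gt0) h) (ltW dl0).
set D := N * (Z + g) ^+ 2.
have D0 : 0 <= D by rewrite mulr_ge0 // sqr_ge0.
have g2 : 0 < g ^+ 2 by rewrite exprn_gt0.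
(* With this step length the second-order terms [s^2 (M + D)] consume at most half of the
   first-order gain [s g^2]. *)
set s := g ^+ 2 / (2 * (M + D + g ^+ 2)).
have den : 0 < 2 * (M + D + g ^+ 2) by lra.
have s0 : 0 < s by rewrite divr_gt0.
have s1 : s <= 1 by rewrite /s ler_pdivrMr //; lra.
have sE : s * (2 * (M + D + g ^+ 2)) = g ^+ 2 by rewrite /s divfK // gt_eqF.
clearbody s; exists (s * g ^+ 2 / 2); first by have := mulr_gt0 s0 g2; lra.
move=> z Kz zM zg; set d := fun i => pos (z i - g).
have [|z' [Kz' z'E]] := @K_response (fun i => d i + dl).
  by move=> i; rewrite ltr_wpDl // /d pos_ge0.
exists (fun i => (1 - s) * z i + s * z' i); split.
  by apply: K_convex => //; rewrite ltW.
have sumdl : \sum_(i : I) dl = N * dl by rewrite sumr_const -mulr_natl.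
have cross : \sum_i d i * (z' i - g) <= g ^+ 2 / 2.
  have h1 : \sum_i (d i + dl) * (z' i - g) <= 0.
    under eq_bigr do rewrite mulrBr.
    by rewrite sumrB -mulr_suml subr_le0 (le_trans z'E) // mulrC.
  have h2 : - (dl * N * g) <= dl * \sum_i (z' i - g).
    rewrite sumrB sumr_const -[g *+ _]mulr_natl -/N.
    have : 0 <= dl * \sum_i z' i by rewrite mulr_ge0 ?(ltW dl0) // sumr_ge0 // => i _; exact: K_ge0.
    lra.
  have h3 : \sum_i (d i + dl) * (z' i - g) =
      \sum_i d i * (z' i - g) + dl * \sum_i (z' i - g).
    by rewrite mulr_sumr -big_split /=; apply: eq_bigr => i _; rewrite mulrDl.
  have h4 := ler_wpM2r (ltW g_gt0) dlN; rewrite h3 in h1; lra.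
have z'Z i : z' i <= Z.
  have h1 : dl * z' i <= g * (N + M + N * dl).
    apply: le_trans (le_trans z'E _).
      rewrite (bigD1 i) //= -[leLHS]addr0 lerD //.
        by rewrite ler_wpM2r ?K_ge0 // lerDr pos_ge0.
      by apply: sumr_ge0 => j _; rewrite mulr_ge0 ?K_ge0 // addr_ge0 ?(ltW dl0) // /d pos_ge0.
    rewrite ler_wpM2l ?(ltW g_gt0) // big_split /= sumdl lerD2r.
    apply: (@le_trans _ _ (\sum_i (1 + d i ^+ 2))).
      apply: ler_sum => j _; have := sqr_ge0 (d j - 1); have := pos_ge0 (z j - g).
      by rewrite -/(d j); lra.
    by rewrite big_split /= sumr_const lerD2l.
  by rewrite /Z ler_pdivlMr // mulrC.
have sq : \sum_i (z' i - g) ^+ 2 <= D.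
  rewrite /D /N mulr_natl -sumr_const; apply: ler_sum => i _.
  rewrite -real_normK ?num_real // lerXn2r ?nnegrE ?addr_ge0 ?(ltW g_gt0) // ler_norml.
  have := z'Z i; have := K_ge0 i Kz'; have := g_gt0; lra.
apply: le_trans (excess_segment z z' _) _; first by rewrite s1 ltW.
have c1 : (1 - s) * \sum_i d i * (z' i - g) <= g ^+ 2 / 2.
  have [h|h] := leP (\sum_i d i * (z' i - g)) 0.
    apply: (@le_trans _ _ 0); last lra.
    by rewrite mulr_ge0_le0 // subr_ge0.
  by apply: le_trans cross; rewrite ger_pMl //; lra.
have c2 := ler_wpM2l (ltW s0) c1.
have c3 := ler_wpM2l (sqr_ge0 s) sq.
have c4 := ler_wpM2l (sqr_ge0 s) zM.
have c5 := ler_wpM2l (ltW s0) zg.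
have c6 : s ^+ 2 * (2 * (M + D + g ^+ 2)) = s * g ^+ 2 by rewrite expr2 -mulrA sE.
have c7 := mulr_ge0 (sqr_ge0 s) (ltW g2).
rewrite -/d; lra.
Qed.

(** Each descent lowers the nonnegative excess by a fixed [eta], so it eventually falls below [g^2],
    and then no coordinate exceeds [2 g]. The factor [2] takes the place of a compactness
    argument. *)
Theorem minimax_le : exists z, K z /\ forall i, z i <= 2 * g.
Proof.
have [z0 [Kz0 _]] := @K_response (fun=> 1) (fun=> ltr01).
have [eta eta0 desc] := descent (excess z0).
have [n hn] : exists n : nat, excess z0 < eta * n%:R.
  exists (Num.bound (excess z0 / eta)).
  by rewrite mulrC -ltr_pdivrMr // archi_boundP // divr_ge0 // ltW.
have [z [Kz zlt]] : exists z, K z /\ excess z < g ^+ 2.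
  suff [z [Kz [//|h]]] : exists z, K z /\
     (excess z < g ^+ 2 \/ excess z <= excess z0 - eta * n%:R).
  - by exists z.
  - by exists z; split=> //; have := excess_ge0 z; lra.
  clear hn; elim: n => [|n [z [Kz ih]]]; first by exists z0; rewrite mulr0 subr0; auto.
  have [h|h] := ltP (excess z) (g ^+ 2); first by exists z; auto.
  case: ih => ih; first by move: ih; rewrite ltNge h.
  have zz0 : excess z <= excess z0.
    by apply: (le_trans ih); rewrite gerBl mulr_ge0 ?(ltW eta0) ?ler0n.
  have [z' [Kz' z'E]] := desc z Kz zz0 h.
  by exists z'; split=> //; right; rewrite -natr1 mulrDr mulr1; lra.
exists z; split=> // i; rewrite leNgt; apply/negP => zi.
suff : g ^+ 2 <= excess z by rewrite leNgt zlt.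
rewrite /excess (bigD1 i) //= -[leLHS]addr0 lerD //.
  rewrite lerXn2r ?nnegrE ?pos_ge0 ?(ltW g_gt0) // /pos le_max; apply/orP; right; lra.
by apply: sumr_ge0 => j _; exact: sqr_ge0.
Qed.
End Minimax.

(** * Minors and singular values *)

Section CauchyBinet.
Local Open Scope ring_scope.

Lemma det_mulmx_functions (R : comNzRingType) k n (X : 'M[R]_(k, n)) (Y : 'M[R]_(n, k)) :
  \det (X *m Y) =
  \sum_(f : {ffun 'I_k -> 'I_n}) (\prod_i X i (f i)) * \det (rowsub f Y).
Proof.
pose XY (s : 'S_k) i j := X i j * Y j (s i).
transitivity (\sum_(f : {ffun 'I_k -> 'I_n}) \sum_(s : 'S_k)
    (-1) ^+ s * \prod_i XY s i (f i)).
  rewrite exchange_big; apply: eq_bigr => /= s _; rewrite -big_distrr /=.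
  congr (_ * _); rewrite -(bigA_distr_bigA (XY s)) /=.
  by apply: eq_bigr => x _; rewrite mxE.
apply: eq_bigr => f _; rewrite big_distrr /=; apply: eq_bigr => s _.
rewrite mulrCA big_split //=; congr (_ * (_ * _)).
by apply: eq_bigr => x _; rewrite mxE.
Qed.

(* Summing over all index functions instead of increasing ones only changes
   the Cauchy-Binet formula by the factor [k`!]. *)
Lemma cauchy_binet (R : comNzRingType) k n (X : 'M[R]_(k, n)) (Y : 'M[R]_(n, k)) :
  k`!%:R * \det (X *m Y) =
  \sum_(f : {ffun 'I_k -> 'I_n}) \det (colsub f X) * \det (rowsub f Y).
Proof.
have perm (s : 'S_k) : \det (X *m Y) = \sum_(f : {ffun 'I_k -> 'I_n})
    (-1) ^+ s * (\prod_i X i (f (s i))) * \det (rowsub f Y).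
  rewrite det_mulmx_functions.
  pose h (s : 'S_k) (f : {ffun 'I_k -> 'I_n}) := [ffun i => f (s i)].
  have hK : cancel (h s) (h s^-1%g).
    by move=> f; apply/ffunP => i; rewrite !ffunE permKV.
  rewrite (reindex_inj (can_inj hK)) /=; apply: eq_bigr => f _.
  have -> : rowsub (h s f) Y = row_perm s (rowsub f Y).
    by apply/matrixP => i j; rewrite !mxE ffunE.
  rewrite row_permE det_mulmx det_perm mulrA [_ * (-1) ^+ _]mulrC.
  by congr (_ * _ * _); apply: eq_bigr => i _; rewrite ffunE.
rewrite -(card_Sn k) mulr_natl -sumr_const.
under eq_bigr => s _ do rewrite (perm s).
rewrite exchange_big /=; apply: eq_bigr => f _.
rewrite -mulr_suml; congr (_ * _); apply: eq_bigr => s _; congr (_ * _).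
by apply: eq_bigr => i _; rewrite mxE.
Qed.
End CauchyBinet.
Section Minors.
Local Open Scope ring_scope.
Local Open Scope sesquilinear_scope.
Context (C : numClosedFieldType).

Definition minors2 m n (W : 'M[C]_(m, n)) k (f : 'I_k -> 'I_m) (g : 'I_k -> 'I_n) : C :=
  `|\det (mxsub f g W)| ^+ 2.

Lemma det_adjoint k (A : 'M[C]_k) : \det (A ^t*) = (\det A)^*.
Proof. by rewrite det_map_mx det_tr. Qed.

Lemma minors2_row m n (W : 'M[C]_(m, n)) k (f : 'I_k -> 'I_m) :
  \sum_(g : {ffun 'I_k -> 'I_n}) minors2 W f g =
  k`!%:R * \det (mxsub f f (W *m W ^t*)).
Proof.
have -> : mxsub f f (W *m W ^t*) = rowsub f W *m (rowsub f W) ^t*.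
  apply/matrixP => i j; rewrite !mxE; apply: eq_bigr => l _.
  by rewrite !mxE.
rewrite cauchy_binet; apply: eq_bigr => g _; rewrite /minors2 normCK.
rewrite -det_adjoint; congr (_ * _); congr determinant; apply/matrixP => i j.
  by rewrite !mxE.
by rewrite !mxE.
Qed.

Lemma minors2_adjoint m n (W : 'M[C]_(m, n)) k (f : 'I_k -> 'I_m) (g : 'I_k -> 'I_n) :
  minors2 (W ^t*) g f = minors2 W f g.
Proof.
rewrite /minors2; have -> : mxsub g f (W ^t*) = (mxsub f g W) ^t*.
  by apply/matrixP => i j; rewrite !mxE.
by rewrite det_adjoint norm_conjC.
Qed.

Lemma minors2_col m n (W : 'M[C]_(m, n)) k (g : 'I_k -> 'I_n) :
  \sum_(f : {ffun 'I_k -> 'I_m}) minors2 W f g =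
  k`!%:R * \det (mxsub g g (W ^t* *m W)).
Proof.
under eq_bigr do rewrite -minors2_adjoint.
by rewrite minors2_row trmxCK.
Qed.

(** This is [k!^2] times the [k]-th elementary symmetric polynomial of the squared singular values
    of [W]. *)
Definition minors2_sum m n (W : 'M[C]_(m, n)) k : C :=
  \sum_(f : {ffun 'I_k -> 'I_m}) \sum_(g : {ffun 'I_k -> 'I_n}) minors2 W f g.

(** For fixed columns, the sum over row choices depends only on the Gram matrix of the columns,
    which a unitary preserves. *)
Lemma minors2_sum_unitary m n (U : 'M[C]_m) (W : 'M[C]_(m, n)) k :
  U \is unitarymx -> minors2_sum (U *m W) k = minors2_sum W k.
Proof.
move=> uU; rewrite /minors2_sum exchange_big [RHS]exchange_big /=.
apply: eq_bigr => g _; rewrite !minors2_col; congr (_ * \det (mxsub _ _ _)).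
rewrite trmx_mul map_mxM mulmxA -(mulmxA (W ^t*)) -invmx_unitary //.
by rewrite mulVmx ?mulmx1 // unitarymx_unit.
Qed.

(** Only the [k!] row choices that enumerate [S] are kept; by [minors2_row] each contributes [k!]
    times a principal minor of the diagonal matrix. *)
Lemma minors2_sum_diag m n (W : 'M[C]_(m, n)) (d : 'rV[C]_m) (S : {set 'I_m}) :
  W *m W ^t* = diag_mx d ->
  #|S|`!%:R ^+ 2 * \prod_(i in S) d 0 i <= minors2_sum W #|S|.
Proof.
move=> Wd; set k := #|S|.
pose h (s : 'S_k) : {ffun 'I_k -> 'I_m} := [ffun i => enum_val (s i)].
have h_inj : injective h.
  move=> s t /ffunP st; apply/permP => i; apply: (@enum_val_inj _ (mem S)).
  by have := st i; rewrite !ffunE.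
have hE s : \sum_(g : {ffun 'I_k -> 'I_n}) minors2 W (h s) g =
    k`!%:R * \prod_(i in S) d 0 i.
  rewrite minors2_row Wd.
  have -> : mxsub (h s) (h s) (diag_mx d) = diag_mx (\row_i d 0 (h s i)).
    apply/matrixP => i j; rewrite !mxE; congr (_ *+ _).
    by rewrite !ffunE (inj_eq enum_val_inj) (inj_eq perm_inj).
  rewrite det_diag; congr (_ * _).
  rewrite [RHS]big_enum_val [RHS](reindex_inj (@perm_inj _ s)) /=.
  by apply: eq_bigr => i _; rewrite mxE ffunE.
have -> : k`!%:R ^+ 2 * \prod_(i in S) d 0 i =
    \sum_(f in [set h s | s : 'S_k]) \sum_(g : {ffun 'I_k -> 'I_n}) minors2 W f g.
  rewrite big_imset /=; last by move=> s t _ _; exact: h_inj.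
  rewrite (eq_bigr _ (fun s _ => hE s)) sumr_const card_Sn.
  by rewrite -[RHS]mulr_natl mulrA.
rewrite /minors2_sum [leRHS](bigID [in [set h s | s : 'S_k]]) /= lerDl.
by apply: sumr_ge0 => f _; apply: sumr_ge0 => g _; rewrite exprn_ge0.
Qed.
End Minors.

(** * From minors to sums of singular values *)

Section Nuclear.
Local Open Scope ring_scope.

Lemma bin_le_exp2 n k : ('C(n, k) <= 2 ^ n)%N.
Proof.
elim: n k => [|n ihn] [|k] //; first by rewrite bin0 expn_gt0.
by rewrite binS expnS mul2n -addnn leq_add.
Qed.

(** [k^k <= (k + 1) ... (2 k) = C(2 k, k) k!], and the binomial coefficient is at most [4^k]. *)
Lemma expnn_le_fact k : (k ^ k <= 4 ^ k * k`!)%N.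
Proof.
apply: (@leq_trans ('C(k + k, k) * k`!)).
  rewrite bin_ffact ffact_prod -[X in (_ ^ X)%N](card_ord k) -prod_nat_const.
  by apply: leq_prod => i _; rewrite -addnBA ?leq_addr // ltnW.
by rewrite leq_mul2r (leq_trans (bin_le_exp2 _ _)) ?orbT // addnn -mul2n expnM.
Qed.

Context (R : rcfType).

Lemma fact_exp_le k (t D : R) : 0 <= t -> 0 <= D ->
  k`!%:R * t ^+ k <= D ^+ k -> k%:R * t <= 4 * D.
Proof.
case: k => [|k] t0 D0 h; first by rewrite mul0r mulr_ge0.
rewrite -(@ler_pXn2r _ k.+1) ?nnegrE ?mulr_ge0 ?ler0n // !exprMn.
apply: (@le_trans _ _ (4 ^+ k.+1 * k.+1`!%:R * t ^+ k.+1)).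
  rewrite ler_wpM2r ?exprn_ge0 // -!natrX -natrM ler_nat; exact: expnn_le_fact.
by rewrite -mulrA ler_wpM2l ?exprn_ge0.
Qed.

Definition harmonic (n : nat) : R := \sum_(k < n) k.+1%:R^-1.

Lemma harmonic_gt0 n : (0 < n)%N -> 0 < harmonic n.
Proof.
case: n => // n _; rewrite /harmonic big_ord_recl /= invr1.
by rewrite ltr_pwDl // sumr_ge0 // => i _; rewrite invr_ge0 ler0n.
Qed.

(** The hypothesis bounds the [j]-th largest value by [D / j]; removing the smallest element each
    time adds these bounds up. *)
Lemma sum_le_harmonic (I : finType) (sg : I -> R) (D : R) :
  (forall (S : {set I}) t, (forall i, i \in S -> t <= sg i) -> 0 <= t ->
     #|S|%:R * t <= D) -> (forall i, 0 <= sg i) ->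
  forall S : {set I}, \sum_(i in S) sg i <= D * harmonic #|S|.
Proof.
move=> lev sg0 S; move En : #|S| => n; elim: n S En => [|n ihn] S Sn.
  by move/eqP: Sn; rewrite cards_eq0 => /eqP->; rewrite big_set0 /harmonic big_ord0 mulr0.
have /card_gt0P[p pS] : (0 < #|S|)%N by rewrite Sn.
case: (@arg_minP _ _ _ p [in S] sg pS) => i iS imin.
rewrite (bigD1 i) //= /harmonic big_ord_recr /= mulrDr addrC lerD //.
  have := ihn (S :\ i); rewrite (cardsD1 i) iS in Sn.
  move=> /(_ (succn_inj Sn)); apply: le_trans; rewrite le_eqVlt; apply/orP; left.
  by apply/eqP; apply: eq_bigl => j; rewrite !inE andbC.
have := lev S (sg i) imin (sg0 i); rewrite Sn => h.
by rewrite ler_pdivlMr ?ltr0n // mulrC.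
Qed.

Local Open Scope complex_scope.
Local Open Scope sesquilinear_scope.

Lemma norm2_complex (x : R) : `|x%:C| ^+ 2 = (x ^+ 2)%:C :> R[i].
Proof. by rewrite -add_Re2_Im2 /= expr0n addr0. Qed.

Lemma spectral_rows m n (M : 'M[R]_(m, n)) : exists U : 'M[R[i]]_m,
  exists d : 'rV[R[i]]_m, U \is unitarymx /\
  (U *m map_mx (real_complex R) M) *m (U *m map_mx (real_complex R) M) ^t* = diag_mx d.
Proof.
set Mc := map_mx _ M; set A := Mc *m Mc ^t*.
have Ah : A \is normalmx.
  apply/normalmxP; have -> // : A ^t* = A.
  by rewrite /A trmx_mul map_mxM trmxCK.
exists (spectralmx A), (spectral_diag A); split; first exact: spectral_unitarymx.
move/orthomx_spectralP: (Ah) => AE.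
rewrite trmx_mul map_mxM mulmxA -(mulmxA _ Mc) -/A.
rewrite [X in _ *m X *m _]AE -invmx_unitary ?spectral_unitarymx //.
have uP := spectral_unit A.
by rewrite !mulmxA mulmxV // mul1mx mulmxK.
Qed.

(** A unitary [U] makes the rows of [W = U M] orthogonal, with the singular values [sg] as lengths.
    The minors give [k! prod sg <= D^k] on every [k]-set, which bounds the sum of [sg]; each
    singular value is then split evenly between the two factors. *)
Theorem nuclear_factorization m n (M : 'M[R]_(m, n)) (D : R) : 0 <= D ->
  (forall k, \sum_(f : {ffun 'I_k -> 'I_m}) \sum_(g : {ffun 'I_k -> 'I_n})
     \det (mxsub f g M) ^+ 2 <= (D ^+ k) ^+ 2) ->
  exists (b : 'I_m -> 'I_m * bool -> R) (c : 'I_n -> 'I_m * bool -> R),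
  [/\ forall i j, \sum_t b i t * c j t = M i j,
      \sum_i \sum_t b i t ^+ 2 <= 4 * D * harmonic m &
      \sum_j \sum_t c j t ^+ 2 <= 4 * D * harmonic m].
Proof.
move=> D0 minors; have [U [d [uU dE]]] := spectral_rows M.
set W := U *m map_mx (real_complex R) M in dE.
pose rho i : R := \sum_j (complex.Re (W i j) ^+ 2 + complex.Im (W i j) ^+ 2).
have rho0 i : 0 <= rho i by apply: sumr_ge0 => j _; rewrite addr_ge0 ?sqr_ge0.
have drho i : d 0 i = (rho i)%:C.
  have /matrixP/(_ i i) := dE; rewrite !mxE eqxx mulr1n => <-.
  rewrite /rho rmorph_sum /=; apply: eq_bigr => j _.
  by rewrite add_Re2_Im2 normCK !mxE.
pose sg i := Num.sqrt (rho i).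
have sg2 i : sg i ^+ 2 = rho i by rewrite sqr_sqrtr.
have prod_le (S : {set 'I_m}) : #|S|`!%:R * \prod_(i in S) sg i <= D ^+ #|S|.
  rewrite -(@ler_pXn2r _ 2) ?nnegrE ?exprn_ge0 //; last first.
    by rewrite mulr_ge0 ?ler0n // prodr_ge0 // => i _; exact: sqrtr_ge0.
  apply: le_trans (minors _); rewrite -lecR.
  have := minors2_sum_diag S dE; rewrite minors2_sum_unitary //.
  congr (_ <= _).
    rewrite exprMn rmorphM /= rmorphXn /= rmorph_nat; congr (_ * _).
    rewrite -prodrXl rmorph_prod /=.
    by apply: eq_bigr => i _; rewrite drho sg2.
  rewrite /minors2_sum rmorph_sum /=; apply: eq_bigr => f _.
  rewrite rmorph_sum /=; apply: eq_bigr => g _.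
  by rewrite /minors2 -map_mxsub det_map_mx norm2_complex.
have lev (S : {set 'I_m}) t : (forall i, i \in S -> t <= sg i) -> 0 <= t ->
    #|S|%:R * t <= 4 * D.
  move=> tS t0; apply: fact_exp_le => //; apply: le_trans (prod_le S).
  rewrite ler_wpM2l ?ler0n // -prodr_const.
  by apply: ler_prod => i iS; rewrite t0 tS.
have := sum_le_harmonic lev (fun i => sqrtr_ge0 (rho i)) setT.
rewrite cardsT card_ord => sumsg.
have {}sumsg : \sum_i sg i <= 4 * D * harmonic m.
  apply: le_trans sumsg; rewrite le_eqVlt; apply/orP; left; apply/eqP.
  by apply: eq_bigl => i; rewrite inE.
(* The real part of a complex inner product is a real inner product over real and imaginary parts,
   whence the boolean in the index. *)
pose part (z : R[i]) (e : bool) := if e then complex.Im z else complex.Re z.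
have sum_part (a : 'I_m -> R) (z : 'I_m -> R[i]) (z' : 'I_m -> R[i]) :
    \sum_(t : 'I_m * bool) a t.1 * (part (z t.1) t.2 * part (z' t.1) t.2) =
    \sum_i a i * (complex.Re (z i) * complex.Re (z' i) + complex.Im (z i) * complex.Im (z' i)).
  rewrite -(pair_bigA _ (fun i e => a i * (part (z i) e * part (z' i) e))) /=.
  by apply: eq_bigr => i _; rewrite big_bool /part /= -mulrDr addrC.
exists (fun i t => Num.sqrt (sg t.1) * part (U t.1 i) t.2).
exists (fun j t => (Num.sqrt (sg t.1))^-1 * part (W t.1 j) t.2).
have sgsq i : Num.sqrt (sg i) ^+ 2 = sg i by rewrite sqr_sqrtr // sqrtr_ge0.
(* Where [sg] vanishes the row of [W] is zero, so the default value [0] of the inverse is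
   harmless. *)
have W0 i j : sg i = 0 -> complex.Re (W i j) = 0 /\ complex.Im (W i j) = 0.
  move=> /(congr1 (fun x => x ^+ 2)); rewrite sg2 expr0n /= => /eqP.
  rewrite psumr_eq0 => [/allP/(_ j)|k _]; last by rewrite addr_ge0 ?sqr_ge0.
  rewrite mem_index_enum => /(_ isT); rewrite paddr_eq0 ?sqr_ge0 //.
  by rewrite !sqrf_eq0 => /andP[/eqP-> /eqP->].
have ME : map_mx (real_complex R) M = U ^t* *m W.
  by rewrite /W -invmx_unitary // mulKmx // unitarymx_unit.
clearbody W; split.
- move=> i j; transitivity (\sum_k (complex.Re (U k i) * complex.Re (W k j) +
      complex.Im (U k i) * complex.Im (W k j))).
    transitivity (\sum_(t : 'I_m * bool) (Num.sqrt (sg t.1) / Num.sqrt (sg t.1)) *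
        (part (U t.1 i) t.2 * part (W t.1 j) t.2)).
      by apply: eq_bigr => t _; ring.
    rewrite (sum_part (fun k => Num.sqrt (sg k) / Num.sqrt (sg k)) (fun k => U k i)
      (fun k => W k j)); apply: eq_bigr => k _.
    have [s0|sn] := eqVneq (sg k) 0; first by have [-> ->] := W0 k j s0; rewrite !mulr0 addr0 mulr0.
    rewrite divff ?mul1r // sqrtr_eq0 -ltNge lt_neqAle eq_sym sn; exact: sqrtr_ge0.
  move: ME => /matrixP/(_ i j); rewrite !mxE => /(congr1 (@complex.Re R)) /= ->.
  rewrite (big_morph (@complex.Re R) (id1 := 0) (op1 := +%R)); first last.
  - by [].
  - by move=> [? ?] [? ?].
  apply: eq_bigr => k _.
  by rewrite !mxE; case: (U k i) => a b; case: (W k j) => a' b' /=; ring.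
- apply: le_trans sumsg; rewrite le_eqVlt; apply/orP; left; apply/eqP.
  transitivity (\sum_i \sum_k sg k *
      (complex.Re (U k i) * complex.Re (U k i) + complex.Im (U k i) * complex.Im (U k i))).
    apply: eq_bigr => i _; rewrite -(sum_part sg (fun k => U k i) (fun k => U k i)).
    by apply: eq_bigr => t _; rewrite exprMn sgsq.
  rewrite exchange_big /=; apply: eq_bigr => k _.
  rewrite -mulr_sumr -[RHS]mulr1; congr (_ * _); apply: complexI.
  have /unitarymxP/matrixP/(_ k k) := uU; rewrite !mxE eqxx => uk.
  apply: etrans uk.
  rewrite rmorph_sum /=; apply: eq_bigr => i _.
  by rewrite !mxE -normCK -add_Re2_Im2.
- apply: le_trans sumsg; rewrite le_eqVlt; apply/orP; left; apply/eqP.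
  transitivity (\sum_j \sum_k (sg k)^-1 *
      (complex.Re (W k j) * complex.Re (W k j) + complex.Im (W k j) * complex.Im (W k j))).
    apply: eq_bigr => j _.
    rewrite -(sum_part (fun k => (sg k)^-1) (fun k => W k j) (fun k => W k j)).
    by apply: eq_bigr => t _; rewrite exprMn exprVn sgsq.
  rewrite exchange_big /=; apply: eq_bigr => k _.
  rewrite -mulr_sumr -/(rho k) -sg2.
  by have [->|sn] := eqVneq (sg k) 0; rewrite ?invr0 ?mul0r // expr2 mulKf.
Qed.
End Nuclear.

(** * Determinants and hereditary discrepancy *)

Section DeterminantBound.
Local Open Scope ring_scope.
Context (k : nat) (B : 'M[int]_k) (h : nat).
Hypothesis B_le1 : forall i j, `|B i j| <= 1.
Hypothesis hered : forall J : {set 'I_k}, exists x : 'I_k -> bool,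
  forall i, `|\sum_(j in J) B i j * (-1) ^+ x j| <= h%:Z.

(** Hereditary signs on the odd coordinates round [Y] to an even vector [2 Y']; recursion on [Y']
    gives the error [h + 2 h (2^L - 1) = h (2^(L+1) - 1)]. *)
Lemma dyadic_rounding L (Y : 'cV[int]_k) : exists X : 'cV[int]_k,
  forall i, `|(B *m (2 ^+ L *: X - Y)) i 0| <= h%:Z * (2 ^+ L - 1).
Proof.
elim: L Y => [|L ihL] Y.
  by exists Y => i; rewrite expr0 scale1r !subrr mulmx0 mxE normr0 mulr0.
pose r j := modz (Y j 0) 2.
have r01 j : r j = 0 \/ r j = 1.
  have h0 : 0 <= r j by exact: modz_ge0.
  have h1 : r j < 2 by exact: ltz_pmod.
  by case: (r j) h0 h1 => // [[|[|?]]]; auto.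
have [x xE] := hered [set j | r j == 1].
pose xs := \col_j (if r j == 1 then (-1) ^+ x j else 0 : int).
pose Y' := \col_j (divz (Y j 0) 2 + (if (r j == 1) && ~~ x j then 1 else 0)).
have YE : 2 *: Y' = Y + xs.
  apply/matrixP => i j; rewrite ord1 !mxE mulrDr.
  rewrite [in RHS](divz_eq (Y i 0) 2) -/(r i) [2 * _]mulrC -addrA; congr (_ + _).
  by case: (r01 i) => ->; rewrite //=; case: (x i).
have [X XE] := ihL Y'; exists X => i.
have -> : 2 ^+ L.+1 *: X - Y = 2 *: (2 ^+ L *: X - Y') + xs.
  rewrite exprS -scalerA scalerBr YE opprD addrA subrK //.
rewrite mulmxDr -scalemxAr mxE [(2 *: _ : 'cV_k) i 0]mxE.
apply: (le_trans (ler_normD _ _)); rewrite normrM normr_nat.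
have hx : `|(B *m xs) i 0| <= h%:Z.
  apply: le_trans (xE i); rewrite mxE [X in _ <= `|X|]big_mkcond le_eqVlt; apply/orP; left.
  apply/eqP; congr `|_|; apply: eq_bigr => j _; rewrite mxE inE.
  by case: ifP; rewrite ?mulr0.
have := XE i; rewrite exprS; lra.
Qed.

(* Every coset of the lattice [B Z^k] meets the cube [[-h, h]^k]; as there are
   [`|\det B|] cosets, this bounds the determinant. *)
Lemma lattice_covering (z : 'cV[int]_k) : \det B != 0 ->
  exists X : 'cV[int]_k, forall i, `|(B *m X - z) i 0| <= h%:Z.
Proof.
set d := \det B => d0.
have divE (v : 'cV[int]_k) :
    v = d *: (\col_j divz (v j 0) d) + \col_j modz (v j 0) d.
  by apply/matrixP => i j; rewrite ord1 !mxE mulrC -divz_eq.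
(* [a / d] is [2^k] times the rational solution [v] of [B v = z]; [Y] is its integer rounding, with
   remainder [r]. *)
pose a := 2 ^+ k *: (\adj B *m z).
pose Y := \col_j divz (a j 0) d; pose r := \col_j modz (a j 0) d.
have aE : a = d *: Y + r by exact: divE.
have [X XE] := dyadic_rounding k Y; exists X => i.
have Br : `|(B *m r) i 0| <= k%:Z * `|d|.
  rewrite mxE (le_trans (ler_norm_sum _ _ _)) //.
  have -> : k%:Z * `|d| = \sum_(j < k) `|d| by rewrite sumr_const card_ord -mulr_natl natz.
  apply: ler_sum => j _; rewrite normrM mxE.
  rewrite -[leRHS]mul1r ler_pM // ger0_norm ?modz_ge0 // ltW //; exact: ltz_mod.
have key : d * (2 ^+ k * (B *m X - z) i 0) =
    d * (B *m (2 ^+ k *: X - Y)) i 0 - (B *m r) i 0.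
  have ZE (c : int) (v : 'cV[int]_k) : c * v i 0 = (c *: v) i 0 by rewrite mxE.
  have SE (v v' : 'cV[int]_k) : v i 0 - v' i 0 = (v - v') i 0 by rewrite !mxE.
  rewrite !ZE SE.
  congr (fun_of_matrix _ i 0).
  have rE : r = a - d *: Y by rewrite aE addrC addKr.
  rewrite rE /a mulmxBr !mulmxBr -!scalemxAr mulmxA mul_mx_adj -/d mul_scalar_mx.
  by rewrite !scalerBr opprB !addrA subrK; congr (_ - _); rewrite !scalerA mulrC.
have := congr1 Num.norm key; rewrite !normrM => key'.
have dp : 0 < `|d| by rewrite normr_gt0.
have p0 : 0 < 2 ^+ k :> int by rewrite exprn_gt0.
have kp : k%:Z < 2 ^+ k by rewrite -natrX natz ltz_nat ltn_expl.
rewrite (gtr0_norm p0) in key'.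
have : `|d| * (2 ^+ k * `|(B *m X - z) i 0|) <=
    `|d| * (h%:Z * (2 ^+ k - 1) + k%:Z).
  rewrite key' (le_trans (ler_normB _ _)) // mulrDr lerD //.
    by rewrite normrM ler_wpM2l.
  by rewrite mulrC.
rewrite ler_pM2l // => le1.
(* The rounding loss [k] is less than [2^k], so the error is below [h + 1]; being an integer, it is
   at most [h]. *)
have : 2 ^+ k * `|(B *m X - z) i 0| < 2 ^+ k * (h%:Z + 1).
  apply: (le_lt_trans le1); have : 0 <= h%:Z by []. lra.
by rewrite ltr_pM2l // ltzD1.
Qed.

Theorem det_le_exp : `|\det B| <= (h.*2.+1 ^ k)%:Z.
Proof.
have [->|d0] := eqVneq (\det B) 0; first by rewrite normr0.
have [L uL [Q uQ [d _ BE]]] := int_Smith_normal_form B.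
set D := \matrix_(i, j) _ in BE.
have DE : D = diag_mx (\row_i d`_i).
  by apply/matrixP => i j; rewrite !mxE -val_eqE.
have unit1 (M : 'M[int]_k) : M \in unitmx -> `|\det M| = 1.
  by rewrite unitmxE qualifE /= => /orP[] /eqP ->.
have detB : `|\det B| = \prod_(i < k) `|d`_i|.
  rewrite BE !det_mulmx !normrM (unit1 L) // (unit1 Q) // mulr1 mul1r DE det_diag normr_prod.
  by apply: eq_bigr => i _; rewrite mxE.
have dn0 (i : 'I_k) : d`_i != 0.
  apply: contra d0 => /eqP di; rewrite -normr_eq0 detB (bigD1 i) //= di.
  by rewrite normr0 mul0r.
(* The [ev e] represent the cosets of [D Z^k], so the [L *m ev e] represent those of [B Z^k]. *)
pose ev (e : {dffun forall i : 'I_k, 'I_(absz d`_i)}) : 'cV[int]_k := \col_i (e i : nat)%:Z.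
have /fin_all_exists[X XE] := fun e => lattice_covering (L *m ev e) d0.
pose y e i := (B *m X e - L *m ev e) i 0.
have yE e i : (B *m X e - L *m ev e) i 0 = y e i by [].
have yh e i : - h%:Z <= y e i <= h%:Z by rewrite -ler_norml -yE.
clearbody y; clear XE.
(* Adding [h] shifts the interval from [-h] to [h] onto the [2 h + 1] code values. *)
pose code e : {ffun 'I_k -> 'I_(h.*2.+1)} := [ffun i => inord (absz (y e i + h%:Z))].
have y0 e i : 0 <= y e i + h%:Z by rewrite -lerBlDr sub0r; case/andP: (yh e i).
have code_inj : injective code.
  move=> e e' /ffunP ee'; have yy' i : y e i = y e' i.
    have := congr1 val (ee' i); rewrite !ffunE /= !inordK; last 2 first.
    - rewrite ltnS -lez_nat gez0_abs // -addnn PoszD.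
      by rewrite lerD2r; case/andP: (yh e' i).
    - rewrite ltnS -lez_nat gez0_abs // -addnn PoszD.
      by rewrite lerD2r; case/andP: (yh e i).
    move=> /(congr1 Posz); rewrite !gez0_abs //; exact: addIr.
  have eqv : B *m X e - L *m ev e = B *m X e' - L *m ev e'.
    by apply/matrixP => i j; rewrite ord1 !yE.
  have eqd : D *m (Q *m (X e - X e')) = ev e - ev e'.
    have : L *m (D *m (Q *m (X e - X e'))) = L *m (ev e - ev e').
      rewrite !mulmxA -BE !mulmxBr.
      have -> : B *m X e = B *m X e' - L *m ev e' + L *m ev e by rewrite -eqv subrK.
      by rewrite [LHS]addrC !addrA addNr add0r addrC.
    by move=> /(congr1 (mulmx (invmx L))); rewrite !mulKmx.
  apply/ffunP => i; apply/val_inj/eqP; rewrite -eqz_nat /=.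
  have /matrixP/(_ i 0) := eqd; rewrite DE mul_diag_mx !mxE => di.
  rewrite -subr_eq0 -di mulf_eq0 (negPf (dn0 i)) /=.
  move: di; set q := (X in _ * X) => di.
  apply: contraT => q0.
  have : `|d`_i| <= `|d`_i * q|.
    by rewrite normrM ler_peMr // -gtz0_ge1 normr_gt0.
  rewrite di; have := ltn_ord (e i); have := ltn_ord (e' i).
  rewrite -!ltz_nat abszE leNgt => h1 h2 /negP; case.
  have g1 : 0 <= (e i : nat)%:Z by []. have g2 : 0 <= (e' i : nat)%:Z by [].
  by rewrite ltr_norml; move: g1 g2 h1 h2; clear; lra.
have := leq_card code code_inj.
rewrite card_ffun card_dep_ffun !card_ord detB foldrE big_map big_enum /=.
rewrite -lez_nat; apply: le_trans; rewrite le_eqVlt; apply/orP; left; apply/eqP.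
rewrite (big_morph Posz PoszM (id1 := 1%N)) //.
by apply: eq_bigr => i _; rewrite card_ord abszE.
Qed.
End DeterminantBound.

(** * Minors of incidence matrices *)

Section Colourings.
Context (V : finType).
Implicit Types (F : {set {set V}}) (J S : {set V}) (x : {ffun V -> bool}).

Lemma bigminn_le (I : eqType) (r : seq I) (G : I -> nat) (n0 : nat) i :
  i \in r -> \big[minn/n0]_(j <- r) G j <= G i.
Proof.
elim: r => // j r ihr; rewrite inE big_cons geq_min => /predU1P[->|/ihr->].
  by rewrite leqnn.
by rewrite orbT.
Qed.

Lemma imbalance_le_card x S : imbalance x S <= #|S|.
Proof.
rewrite -lez_nat /imbalance abszE; apply: (le_trans (ler_norm_sum _ _ _)).
rewrite (eq_bigr (fun=> 1%R)) => [|v _]; last by case: (x v).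
by rewrite sumr_const natz.
Qed.

Lemma disc_attained F : exists x, maxImb F x <= disc F.
Proof.
rewrite /disc; apply: (big_ind (fun m => exists x, maxImb F x <= m)).
- exists [ffun=> true]; apply/bigmax_leqP => S _.
  exact: leq_trans (imbalance_le_card _ _) (max_card _).
- by move=> m n [x hx] [y hy]; case: (leqP m n) => _; [exists x | exists y].
- by move=> x _; exists x.
Qed.

Lemma herdisc_colouring F J : exists x, forall S, S \in F ->
  imbalance x (S :&: J) <= herdisc F.
Proof.
have [x hx] := disc_attained (restrict F J); exists x => S SF.
apply: leq_trans (leq_trans hx (leq_bigmax J)).
by rewrite /maxImb; apply: leq_bigmax_cond; exact: imset_f.
Qed.

Lemma herdisc_obstruction F : F != set0 ->
  exists J, forall x, exists2 S, S \in F & herdisc F <= imbalance x (S :&: J).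
Proof.
move=> /set0Pn[S0 S0F].
have [|J JE] := @bigop.eq_bigmax _ (fun J => disc (restrict F J)).
  by apply/card_gt0P; exists set0.
exists J => x; rewrite /herdisc JE.
have le_disc : disc (restrict F J) <= maxImb (restrict F J) x.
  by apply: bigminn_le; rewrite mem_index_enum.
have [|S' S'F S'E] := @bigop.eq_bigmax_cond _ [in restrict F J] (imbalance x).
  by apply/card_gt0P; exists (S0 :&: J); exact: imset_f.
have /imsetP[S SF S'J] := S'F.
by exists S; rewrite // -S'J -S'E.
Qed.

Local Open Scope ring_scope.

Definition incidence F : 'M[int]_(#|F|, #|V|) :=
  \matrix_(i, j) (enum_val j \in (enum_val i : {set V}))%:R.

Lemma incidence_minor F k (f : 'I_k -> 'I_#|F|) (g : 'I_k -> 'I_#|V|) :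
  `|\det (mxsub f g (incidence F))| <= ((herdisc F).*2.+1 ^ k)%:Z.
Proof.
(* A repeated column makes the minor zero; otherwise sets of columns correspond to subsets of [V],
   where the hereditary bound applies. *)
have [/injectiveP g_inj|/injectivePn[i1 [i2 i12 gi12]]] := boolP (injectiveb g); last first.
  rewrite -det_tr (determinant_alternate i12) ?normr0 // => j.
  by rewrite !mxE gi12.
apply: det_le_exp => [i j|J]; first by rewrite !mxE; case: (_ \in _).
pose g' j := enum_val (g j).
have g'_inj : injective g' by move=> j1 j2 /enum_val_inj/g_inj.
have [x xE] := herdisc_colouring F (g' @: J).
exists (fun j => ~~ x (g' j)) => i.
have := xE _ (enum_valP (f i)); rewrite /imbalance -lez_nat abszE.
congr (`|_| <= _).
transitivity (\sum_(v in g' @: J) if v \in enum_val (f i) then sgn (x v) else 0).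
  by rewrite -big_mkcondr; apply: eq_bigl => v; rewrite inE andbC.
rewrite big_imset /=; last by move=> j1 j2 _ _; exact: g'_inj.
by apply: eq_bigr => j _; rewrite !mxE -/(g' j); case: ifP; case: (x _).
Qed.
End Colourings.

(** * Factorizations of bounded cost *)

Section Factorization.
Local Open Scope ring_scope.

(** Entries are scaled by [sqrt (p i * q j)]. Summed over index functions, the squared minors are at
    most [(P Q)^k H^(2 k)], so [D = H sqrt (P Q)] works; undoing the scaling produces the weights,
    and AM-GM bounds [2 sqrt (P Q)] by [P + Q]. *)
Lemma weighted_factorization (R : rcfType) m n (A : 'M[R]_(m, n)) (H : R)
    (p : 'I_m -> R) (q : 'I_n -> R) : 0 <= H ->
  (forall k (f : 'I_k -> 'I_m) (g : 'I_k -> 'I_n),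
     `|\det (mxsub f g A)| <= H ^+ k) ->
  (forall i, 0 < p i) -> (forall j, 0 < q j) ->
  exists (b : 'I_m -> 'I_m * bool -> R) (c : 'I_n -> 'I_m * bool -> R),
  (forall i j, \sum_t b i t * c j t = A i j) /\
  \sum_i p i * (\sum_t b i t ^+ 2) + \sum_j q j * (\sum_t c j t ^+ 2) <=
    4 * H * harmonic R m * (\sum_i p i + \sum_j q j).
Proof.
move=> H0 minors p0 q0.
set P := \sum_i p i; set Q := \sum_j q j.
have P0 : 0 <= P by apply: sumr_ge0 => i _; exact: ltW.
have Q0 : 0 <= Q by apply: sumr_ge0 => i _; exact: ltW.
pose M : 'M[R]_(m, n) := \matrix_(i, j) (Num.sqrt (p i) * A i j * Num.sqrt (q j)).
set D := H * Num.sqrt (P * Q).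
have D0 : 0 <= D by rewrite mulr_ge0 // sqrtr_ge0.
have minorsM k : \sum_(f : {ffun 'I_k -> 'I_m}) \sum_(g : {ffun 'I_k -> 'I_n})
    \det (mxsub f g M) ^+ 2 <= (D ^+ k) ^+ 2.
  have -> : (D ^+ k) ^+ 2 = \sum_(f : {ffun 'I_k -> 'I_m})
      \sum_(g : {ffun 'I_k -> 'I_n}) (\prod_i p (f i)) * (\prod_i q (g i)) * (H ^+ k) ^+ 2.
    under eq_bigr do rewrite -mulr_suml -mulr_sumr.
    rewrite -!mulr_suml -(bigA_distr_bigA (fun _ i => p i)) -(bigA_distr_bigA (fun _ i => q i)) /=.
    rewrite !prodr_const !card_ord -/P -/Q !(exprAC _ k) -!exprMn.
    by congr (_ ^+ _); rewrite /D exprMn sqr_sqrtr ?mulr_ge0 // mulrC.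
  apply: ler_sum => f _; apply: ler_sum => g _.
  have -> : mxsub f g M = diag_mx (\row_i Num.sqrt (p (f i))) *m mxsub f g A *m
      diag_mx (\row_j Num.sqrt (q (g j))).
    by apply/matrixP => i j; rewrite mul_mx_diag mul_diag_mx !mxE.
  rewrite !det_mulmx !det_diag !exprMn -!prodrXl mulrAC.
  have -> : \prod_i (\row_i Num.sqrt (p (f i))) 0 i ^+ 2 = \prod_i p (f i).
    by apply: eq_bigr => i _; rewrite mxE sqr_sqrtr // ltW.
  have -> : \prod_i (\row_j Num.sqrt (q (g j))) 0 i ^+ 2 = \prod_i q (g i).
    by apply: eq_bigr => i _; rewrite mxE sqr_sqrtr // ltW.
  apply: ler_wpM2l; first by rewrite mulr_ge0 // prodr_ge0 // => i _; exact: ltW.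
  by rewrite -real_normK ?num_real // lerXn2r ?nnegrE ?exprn_ge0.
have [b [c [bc bD cD]]] := nuclear_factorization D0 minorsM.
have sp i : Num.sqrt (p i) != 0 by rewrite sqrtr_eq0 -ltNge.
have sq j : Num.sqrt (q j) != 0 by rewrite sqrtr_eq0 -ltNge.
exists (fun i t => b i t / Num.sqrt (p i)), (fun j t => c j t / Num.sqrt (q j)); split.
  move=> i j; transitivity ((Num.sqrt (p i))^-1 * M i j * (Num.sqrt (q j))^-1).
    rewrite -bc mulr_sumr mulr_suml; apply: eq_bigr => t _; ring.
  by rewrite mxE !mulrA mulVf // mul1r mulfK.
have -> : \sum_i p i * (\sum_t (b i t / Num.sqrt (p i)) ^+ 2) = \sum_i \sum_t b i t ^+ 2.
  apply: eq_bigr => i _; rewrite mulr_sumr; apply: eq_bigr => t _.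
  by rewrite exprMn exprVn sqr_sqrtr ?ltW // mulrC divfK // gt_eqF.
have -> : \sum_j q j * (\sum_t (c j t / Num.sqrt (q j)) ^+ 2) = \sum_j \sum_t c j t ^+ 2.
  apply: eq_bigr => j _; rewrite mulr_sumr; apply: eq_bigr => t _.
  by rewrite exprMn exprVn sqr_sqrtr ?ltW // mulrC divfK // gt_eqF.
apply: (le_trans (lerD bD cD)).
have amgm : 2 * Num.sqrt (P * Q) <= P + Q.
  rewrite sqrtrM //; have := sqr_ge0 (Num.sqrt P - Num.sqrt Q).
  by rewrite sqrrB !sqr_sqrtr //; lra.
have h0 : 0 <= 4 * H * harmonic R m.
  by rewrite !mulr_ge0 // sumr_ge0 // => i _; rewrite invr_ge0 ler0n.
by have := ler_wpM2l h0 amgm; rewrite /D; lra.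
Qed.

Lemma gamma2_factorization (R : archiRcfType) m n (A : 'M[R]_(m, n)) (H : R) :
  0 < H -> (0 < m)%N ->
  (forall k (f : 'I_k -> 'I_m) (g : 'I_k -> 'I_n),
     `|\det (mxsub f g A)| <= H ^+ k) ->
  exists (T : finType) (b : 'I_m -> T -> R) (c : 'I_n -> T -> R),
  [/\ forall i j, \sum_t b i t * c j t = A i j,
      forall i, \sum_t b i t ^+ 2 <= 8 * H * harmonic R m &
      forall j, \sum_t c j t ^+ 2 <= 8 * H * harmonic R m].
Proof.
move=> H0 m0 minors; set g := 4 * H * harmonic R m.
have h0 : 0 < harmonic R m by exact: harmonic_gt0.
have g0 : 0 < g by rewrite !mulr_gt0.
(* [K] collects the profiles of squared lengths of all factorizations of [A], rows and columns
   together. *)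
pose K (z : 'I_m + 'I_n -> R) := exists (T : finType) (b : 'I_m -> T -> R) (c : 'I_n -> T -> R),
  [/\ forall i j, \sum_t b i t * c j t = A i j,
      forall i, z (inl i) = \sum_t b i t ^+ 2 & forall j, z (inr j) = \sum_t c j t ^+ 2].
have [z z' s /andP[s0 s1] [T [b [c [bc zb zc]]]] [T' [b' [c' [bc' zb' zc']]]]
     |z [i|j] [T [b [c [_ zb zc]]]]
     |w w0|z [[T [b [c [bc zb zc]]]] z2g]] := @minimax_le R ('I_m + 'I_n)%type K g g0.
- have s1' : 0 <= 1 - s by rewrite subr_ge0.
  (* Concatenation with weights [sqrt (1 - s)] and [sqrt s] still factorizes [A] and averages the
     profiles, so [K] is convex. *)
  pose glue (a : T -> R) (a' : T' -> R) (t : T + T') :=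
    match t with inl t => Num.sqrt (1 - s) * a t | inr t => Num.sqrt s * a' t end.
  have glueE a1 a1' a2 a2' : \sum_t glue a1 a1' t * glue a2 a2' t =
      (1 - s) * (\sum_t a1 t * a2 t) + s * (\sum_t a1' t * a2' t).
    rewrite big_sumType /= !mulr_sumr; congr (_ + _); apply: eq_bigr => t _.
      by rewrite mulrACA -expr2 sqr_sqrtr.
    by rewrite mulrACA -expr2 sqr_sqrtr.
  exists (T + T')%type, (fun i => glue (b i) (b' i)), (fun j => glue (c j) (c' j)); split.
  + by move=> i j; rewrite glueE bc bc'; ring.
  + move=> i; rewrite zb zb'; under [RHS]eq_bigr do rewrite expr2.
    rewrite glueE; under eq_bigr do rewrite expr2.
    by under [X in _ + _ * X]eq_bigr do rewrite expr2.
  + move=> i; rewrite zc zc'; under [RHS]eq_bigr do rewrite expr2.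
    rewrite glueE; under eq_bigr do rewrite expr2.
    by under [X in _ + _ * X]eq_bigr do rewrite expr2.
- by rewrite zb sumr_ge0 // => t _; exact: sqr_ge0.
- by rewrite zc sumr_ge0 // => t _; exact: sqr_ge0.
- have [b [c [bc le_g]]] := weighted_factorization (ltW H0) minors
    (fun i => w0 (inl i)) (fun j => w0 (inr j)).
  exists (fun s => match s with inl i => \sum_t b i t ^+ 2 | inr j => \sum_t c j t ^+ 2 end).
  by split; [exists ('I_m * bool)%type, b, c | rewrite !big_sumType].
have gE : 2 * g = 8 * H * harmonic R m by rewrite /g; ring.
by exists T, b, c; split=> // [i|j]; rewrite -?zb -?zc -gE z2g.
Qed.
End Factorization.

(** * Colourings from factorizations *)

Section Signs.
Local Open Scope ring_scope.
Context (R : realFieldType) (exp : R -> R).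
Hypothesis exp_addr : forall x y, exp (x + y) = exp x * exp y.
Hypothesis exp_ge_1D : forall x, 1 + x <= exp x.

Lemma exp_le_inv x y : exp x <= exp y -> x <= y.
Proof.
rewrite !leNgt; apply: contra => yx.
have -> : x = y + (x - y) by ring.
have y0 : 0 < exp y.
  rewrite lt_neqAle eq_sym (exp_ge0 exp_addr) andbT; apply/eqP => y0.
  by have := exp_mulN exp_addr exp_ge_1D y; rewrite y0 mul0r => /eqP; rewrite eq_sym oner_eq0.
rewrite exp_addr ltr_pMr //; apply: lt_le_trans (exp_ge_1D _); lra.
Qed.

(** The walk runs on [c v / G] with test vectors [l b i] and [- l b i]; using both signs bounds
    absolute values at the price of [2 * #|I|] exponentials. The scale [l] stays free. *)
Lemma bounded_signs (V T I : finType) (b : I -> T -> R) (c : V -> T -> R) (G l L : R) :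
  0 < G -> 0 < l -> (forall i, \sum_t b i t ^+ 2 <= 1) ->
  (forall v, \sum_t c v t ^+ 2 <= G ^+ 2) -> (2 * #|I|)%:R <= exp L ->
  exists x : V -> bool, forall i,
    l * `|\sum_v (-1) ^+ x v * (\sum_t b i t * c v t)| <= G * (L + 8 * l ^+ 2).
Proof.
move=> G0 l0 b1 cG IL.
pose E : lmodType R := {ffun T -> R^o}.
pose dot (a a' : E) : R := \sum_t a t * a' t.
have dotC a a' : dot a a' = dot a' a by apply: eq_bigr => t _; rewrite mulrC.
have dotDl a1 a2 a' : dot (a1 + a2) a' = dot a1 a' + dot a2 a'.
  by rewrite -big_split /=; apply: eq_bigr => t _; rewrite ffunE mulrDl.
have dotZl s a a' : dot (s *: a) a' = s * dot a a'.
  by rewrite mulr_sumr; apply: eq_bigr => t _; rewrite ffunE -mulrA.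
have dot_ge0 a : 0 <= dot a a by apply: sumr_ge0 => t _; exact: sqr_ge0.
pose u v : E := [ffun t => c v t / G].
pose w (j : I * bool) : E := [ffun t => (-1) ^+ j.2 * l * b j.1 t].
have u1 v : dot (u v) (u v) <= 1.
  have -> : dot (u v) (u v) = (\sum_t c v t ^+ 2) / G ^+ 2.
    by rewrite mulr_suml; apply: eq_bigr => t _; rewrite !ffunE -expr2 exprMn exprVn.
  by rewrite ler_pdivrMr ?exprn_gt0 // mul1r.
have w1 j : dot (w j) (w j) <= l ^+ 2.
  have -> : dot (w j) (w j) = l ^+ 2 * (\sum_t b j.1 t ^+ 2).
    rewrite mulr_sumr; apply: eq_bigr => t _.
    by rewrite !ffunE -expr2 !exprMn sqrr_sign mul1r.
  by rewrite ler_piMr ?sqr_ge0.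
have [x xE] := subgaussian_signs exp_addr exp_ge_1D dotC dotDl dotZl dot_ge0 u1 w.
exists x => i; set X := \sum_v _.
have dotE e : dot (w (i, e)) (\sum_v (-1) ^+ x v *: u v) = (-1) ^+ e * (l / G * X).
  rewrite /dot /X !mulr_sumr.
  under eq_bigr do rewrite sum_ffunE mulr_sumr.
  rewrite exchange_big /=; apply: eq_bigr => v _.
  rewrite !mulr_sumr; apply: eq_bigr => t _; rewrite !ffunE /=.
  by rewrite /GRing.scale /=; ring.
have bound : exp (dot (w (i, (X < 0)%R)) (\sum_v (-1) ^+ x v *: u v)) <= exp (L + 8 * l ^+ 2).
  apply: (@le_trans _ _ (\sum_j exp (8 * dot (w j) (w j)))).
    apply: le_trans xE; rewrite [leRHS](bigD1 (i, (X < 0)%R)) //= lerDl.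
    by apply: sumr_ge0 => j _; exact: exp_ge0.
  apply: (@le_trans _ _ (\sum_(j : I * bool) exp (8 * l ^+ 2))).
    by apply: ler_sum => j _; apply: exp_mono => //; rewrite ler_pM2l.
  rewrite sumr_const card_prod card_bool -[leLHS]mulr_natl exp_addr mulnC.
  by rewrite ler_wpM2r // exp_ge0.
move/exp_le_inv: bound; rewrite dotE mulrCA.
have -> : (-1) ^+ (X < 0)%R * X = `|X| by rewrite [RHS]normrEsign.
by rewrite mulrAC ler_pdivrMr // [leRHS]mulrC.
Qed.
End Signs.

(** * Factorizations of set systems and their unions *)

Section SetSystems.
Local Open Scope ring_scope.
Context (R : archiRcfType).

Lemma herdisc0_notin (V : finType) (F : {set {set V}}) S v :
  herdisc F = 0%N -> S \in F -> v \notin S.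
Proof.
move=> F0 SF; apply/negP => vS; have [x /(_ S SF)] := herdisc_colouring F [set v].
have -> : S :&: [set v] = [set v] by apply/setIidPr; rewrite sub1set.
by rewrite F0 /imbalance big_set1; case: (x v).
Qed.

(** [24 = 8 * 3]: the [8] comes from [gamma2_factorization], the [3] from [2 h + 1 <= 3 h] for
    hereditary discrepancy [h >= 1]. *)
Definition factor_bound (V : finType) (F : {set {set V}}) : R :=
  24 * (herdisc F)%:R * harmonic R #|F|.

Definition factorizes (V T : finType) (F : {set {set V}})
    (b : {set V} -> T -> R) (c : V -> T -> R) (G2 : R) :=
  [/\ forall S v, S \in F -> \sum_t b S t * c v t = (v \in S)%:R,
      forall S, S \in F -> \sum_t b S t ^+ 2 <= 1 &
      forall v, \sum_t c v t ^+ 2 <= G2].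

Lemma set_system_factorization (V : finType) (F : {set {set V}}) : F != set0 ->
  exists (T : finType) (b : {set V} -> T -> R) (c : V -> T -> R),
    factorizes F b c (factor_bound F ^+ 2).
Proof.
(* Zero hereditary discrepancy forces every member to be empty, and zero vectors suffice. *)
move=> /set0Pn[S0 S0F]; have [h0|hn] := eqVneq (herdisc F) 0%N.
  exists unit, (fun _ _ => 0), (fun _ _ => 0); split.
  - by move=> S v SF; rewrite (negPf (herdisc0_notin _ h0 SF)) big1 // => t _; rewrite mul0r.
  - by move=> S SF; rewrite big1 // => t _; rewrite expr0n.
  - by move=> v; rewrite big1 ?sqr_ge0 // => t _; rewrite expr0n.
set H : R := (herdisc F).*2.+1%:R.
have H0 : 0 < H by rewrite ltr0n.
have m0 : (0 < #|F|)%N by apply/card_gt0P; exists S0.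
pose A : 'M[R]_(#|F|, #|V|) := map_mx intr (incidence F).
have minors k (f : 'I_k -> 'I_#|F|) (g : 'I_k -> 'I_#|V|) :
    `|\det (mxsub f g A)| <= H ^+ k.
  rewrite -map_mxsub det_map_mx -intr_norm /H -natrX.
  by have := incidence_minor f g; rewrite -(ler_int R).
have [T [b [c [bc b1 c1]]]] := gamma2_factorization H0 m0 minors.
set g := 8 * H * harmonic R #|F| in b1 c1.
have hp : 0 < harmonic R #|F| by exact: harmonic_gt0.
have g0 : 0 < g by rewrite !mulr_gt0.
have sg0 : Num.sqrt g != 0 by rewrite sqrtr_eq0 -ltNge.
(* Rescaling by [sqrt g] normalizes the [b] side to length at most [1] and leaves length at most [g]
   on the [c] side. *)
exists T, (fun S t => b (enum_rank_in S0F S) t / Num.sqrt g),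
  (fun v t => c (enum_rank v) t * Num.sqrt g); split.
- move=> S v SF; transitivity (A (enum_rank_in S0F S) (enum_rank v)).
    by rewrite -bc; apply: eq_bigr => t _; rewrite mulrACA mulVf // mulr1.
  by rewrite !mxE enum_rankK enum_rankK_in //; case: (v \in S).
- move=> S _; under eq_bigr do rewrite exprMn exprVn sqr_sqrtr ?(ltW g0) //.
  by rewrite -mulr_suml ler_pdivrMr // mul1r.
- move=> v; under eq_bigr do rewrite exprMn sqr_sqrtr ?(ltW g0) //.
  rewrite -mulr_suml; apply: (@le_trans _ _ (g * g)); first by rewrite ler_wpM2r // ltW.
  rewrite -expr2 lerXn2r ?nnegrE ?(ltW g0) //.
    by rewrite /factor_bound !mulr_ge0 ?ler0n // ltW.
  rewrite /factor_bound /g ler_pM2r //.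
  have h1 : 1 <= (herdisc F)%:R :> R by rewrite ler1n lt0n.
  have -> : H = 2 * (herdisc F)%:R + 1 by rewrite /H -[LHS]natr1 -mul2n natrM.
  lra.
Qed.

(** A set may lie in several systems, so [own] selects one; the vector of [S] is supported on that
    block alone, while the vector of [v] concatenates all blocks. *)
Lemma union_factorization (V : finType) t (Fs : 'I_t -> {set {set V}}) :
  (forall i, Fs i != set0) ->
  exists (T : finType) (b : {set V} -> T -> R) (c : V -> T -> R),
    factorizes (\bigcup_(i < t) Fs i) b c (\sum_i factor_bound (Fs i) ^+ 2).
Proof.
move=> Fs0.
pose pack := {T : finType & (({set V} -> T -> R) * (V -> T -> R))%type}.
have /fin_all_exists[P PE] : forall i, exists P : pack,
    factorizes (Fs i) (projT2 P).1 (projT2 P).2 (factor_bound (Fs i) ^+ 2).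
  move=> i; have [T [b [c bc]]] := set_system_factorization (Fs0 i).
  by exists (existT _ T (b, c)).
pose T i := projT1 (P i).
pose b i : {set V} -> T i -> R := (projT2 (P i)).1.
pose c i : V -> T i -> R := (projT2 (P i)).2.
pose own S i := [pick i | S \in Fs i] == Some i.
have ownP S : S \in \bigcup_(i < t) Fs i -> exists2 i, S \in Fs i & forall j, own S j = (j == i).
  move=> /bigcupP[i0 _ Si0]; rewrite /own; case: pickP => [i Si|/(_ i0)]; last by rewrite Si0.
  by exists i => // j; rewrite eq_sym.
have sumE (f : forall i, T i -> R) :
    \sum_(p : {i : 'I_t & T i}) f (tag p) (tagged p) = \sum_i \sum_(tau : T i) f i tau.
  by rewrite sig_big_dep.
exists {i : 'I_t & T i}, (fun S p => if own S (tag p) then b (tag p) S (tagged p) else 0),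
  (fun v p => c (tag p) v (tagged p)); split.
- move=> S v /ownP[i Si ownS].
  rewrite (sumE (fun i tau => (if own S i then b i S tau else 0) * c i v tau)).
  rewrite (bigD1 i) //= ownS eqxx /= [X in _ + X]big1 ?addr0 => [|j ji].
    by have [bc _ _] := PE i; exact: bc.
  by rewrite big1 // => tau _; rewrite ownS (negPf ji) mul0r.
- move=> S /ownP[i Si ownS].
  rewrite (sumE (fun i tau => (if own S i then b i S tau else 0) ^+ 2)).
  rewrite (bigD1 i) //= ownS eqxx /= [X in _ + X]big1 ?addr0 => [|j ji].
    by have [_ b1 _] := PE i; exact: b1.
  by rewrite big1 // => tau _; rewrite ownS (negPf ji) expr0n.
- move=> v; rewrite (sumE (fun i tau => c i v tau ^+ 2)).
  by apply: ler_sum => i _; have [_ _ c1] := PE i; exact: c1.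
Qed.
End SetSystems.

(** * The bound for unions *)

Section UnionBound.
Local Open Scope ring_scope.
Context (R : archiRcfType) (exp : R -> R) (lnn : nat -> R).
Hypothesis exp_addr : forall x y, exp (x + y) = exp x * exp y.
Hypothesis exp_ge_1D : forall x, 1 + x <= exp x.
Hypothesis lnnK : forall n, (0 < n)%N -> exp (lnn n) = n%:R.

Let expge0 := exp_ge0 exp_addr.
Let le_inv := exp_le_inv exp_addr exp_ge_1D.

(** The induction step is [exp (1 / (m + 2)) <= (m + 2) / (m + 1)], which follows from
    [exp r * (1 - r) <= 1]. *)
Lemma exp_harmonic_le m : exp (harmonic R m.+1 - 1) <= m.+1%:R.
Proof.
elim: m => [|m ihm].
  by rewrite /harmonic big_ord1 invr1 subrr (exp0 exp_addr exp_ge_1D).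
have -> : harmonic R m.+2 - 1 = harmonic R m.+1 - 1 + m.+2%:R^-1.
  by rewrite /harmonic [in LHS]big_ord_recr /= addrAC.
set r := m.+2%:R^-1; have m2 : (0 : R) < m.+2%:R by rewrite ltr0n.
have e1 : exp r * (1 - r) <= 1.
  by rewrite -[leRHS](exp_mulN exp_addr exp_ge_1D r) ler_wpM2l // exp_ge_1D.
have e2 : exp r * m.+1%:R <= m.+2%:R.
  have -> : m.+1%:R = m.+2%:R * (1 - r) :> R.
    by rewrite mulrBr mulfV ?gt_eqF // mulr1 -[in RHS]natr1 addrK.
  by rewrite mulrCA ger_pMr.
rewrite exp_addr mulrC; apply: le_trans e2; exact: ler_wpM2l.
Qed.

Lemma lnn_le m n : (0 < m <= n)%N -> lnn m <= lnn n.
Proof.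
move=> /andP[m0 mn]; apply: le_inv.
by rewrite !lnnK ?ler_nat // (leq_trans m0).
Qed.

Lemma lnn2_ge : 1 / 2 <= lnn 2.
Proof.
apply: le_inv; rewrite lnnK //.
have h : exp (1 / 2) * (1 - 1 / 2) <= 1.
  by rewrite -[leRHS](exp_mulN exp_addr exp_ge_1D (1 / 2)) ler_wpM2l.
lra.
Qed.

(** [harmonic R m <= 1 + lnn m], and [1 <= 2 * lnn m] because [lnn 2 >= 1/2]. *)
Lemma harmonic_le_lnn m : (1 < m)%N -> harmonic R m <= 3 * lnn m.
Proof.
move=> m1; have m0 : (0 < m)%N by exact: ltnW.
have h1 : harmonic R m - 1 <= lnn m.
  by apply: le_inv; rewrite lnnK //; case: m m0 {m1} => // m _; exact: exp_harmonic_le.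
have h2 : lnn 2 <= lnn m by apply: lnn_le.
have := lnn2_ge; lra.
Qed.

Lemma lnn_double n : (1 < n)%N -> lnn (2 * n) <= 2 * lnn n.
Proof.
move=> n1; have n0 : (0 < n)%N by exact: ltnW.
apply: le_inv; rewrite lnnK ?muln_gt0 //.
have -> : 2 * lnn n = lnn n + lnn n by ring.
by rewrite exp_addr lnnK // -natrM ler_nat leq_mul2r n1 orbT.
Qed.

(** Colourings use [true] for [+1], exponents of [-1] use it for [-1]; hence the negation. *)
Lemma imbalance_norm (V : finType) (x : V -> bool) (S J : {set V}) :
  (imbalance [ffun v => ~~ x v] (S :&: J))%:R =
  `|\sum_v (-1) ^+ x v * (if v \in J then (v \in S)%:R else 0)| :> R.
Proof.
rewrite /imbalance -[LHS]/((absz _)%:Z%:~R) abszE intr_norm; congr `|_|.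
rewrite rmorph_sum /= big_mkcond /=; apply: eq_bigr => v _.
rewrite inE ffunE; case: (v \in J); case: (v \in S); case: (x v) => //=;
  by rewrite ?mulr0 ?mulr1.
Qed.

Theorem herdisc_union_le (V : finType) t (Fs : 'I_t -> {set {set V}}) :
  (forall i, 2 <= #|Fs i|)%N ->
  (herdisc (\bigcup_(i < t) Fs i))%:R <=
  1296 * Num.sqrt (lnn #|\bigcup_(i < t) Fs i|) *
  Num.sqrt (\sum_(i < t) lnn #|Fs i| ^+ 2 * (herdisc (Fs i))%:R ^+ 2).
Proof.
move=> Fs2; set F := \bigcup_(i < t) Fs i; set Sg := \sum_(i < t) _.
have [F0|Fn0] := eqVneq F set0.
  suff -> : herdisc F = 0%N by rewrite !mulr_ge0 ?sqrtr_ge0.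
  apply/eqP; rewrite -leqn0; apply/bigmax_leqP => J _.
  apply: leq_trans (bigminn_le _ _ (mem_index_enum [ffun=> true])) _.
  by apply/bigmax_leqP => S /imsetP[S']; rewrite F0 inE.
have Fs0 i : Fs i != set0 by rewrite -card_gt0 (leq_trans _ (Fs2 i)).
have F2 : (1 < #|F|)%N.
  have /set0Pn[S /bigcupP[i _ Si]] := Fn0.
  apply: leq_trans (Fs2 i) (subset_leq_card _); exact: (bigcup_sup i).
have Sg0 : 0 <= Sg by apply: sumr_ge0 => i _; rewrite mulr_ge0 ?sqr_ge0.
have [T [b [c [bc b1 c1]]]] := union_factorization R Fs0.
(* [72 = 24 * 3], from [factor_bound] and [harmonic_le_lnn]. *)
set G := 72 * Num.sqrt Sg.
have {}c1 v : \sum_t c v t ^+ 2 <= G ^+ 2.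
  apply: (le_trans (c1 v)); rewrite exprMn sqr_sqrtr // mulr_sumr.
  apply: ler_sum => i _; rewrite /factor_bound -!exprMn.
  have hr : 0 <= harmonic R #|Fs i|.
    by apply: sumr_ge0 => k _; rewrite invr_ge0 ler0n.
  have hl := harmonic_le_lnn (Fs2 i).
  rewrite lerXn2r ?nnegrE ?mulr_ge0 ?ler0n //; first lra.
  have := ler_wpM2l (ler0n R (herdisc (Fs i))) hl; lra.
have [J JE] := herdisc_obstruction Fn0.
have ln0 : 0 < lnn #|F|.
  have : lnn 2 <= lnn #|F| by apply: lnn_le.
  by have := lnn2_ge; lra.
(* If [G] is zero, all [c] vanish, and with them every incidence and the discrepancy;
   [bounded_signs] needs [G] positive. *)
have [G0|Gn0] := eqVneq G 0.
  have [S SF SE] := JE [ffun=> ~~ false].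
  have -> : (herdisc F)%:R = 0 :> R; last by rewrite !mulr_ge0 ?sqrtr_ge0.
  apply/eqP; rewrite pnatr_eq0 -leqn0; apply: (leq_trans SE).
  rewrite leqn0 -(pnatr_eq0 R) imbalance_norm normr_eq0 big1 // => v _.
  have cv0 tau : c v tau = 0.
    have := c1 v; rewrite G0 expr0n /= => cv.
    have /eqP : \sum_t c v t ^+ 2 = 0.
      by apply/eqP; rewrite eq_le cv sumr_ge0 // => i _; exact: sqr_ge0.
    rewrite psumr_eq0 => [/allP/(_ tau)|i _]; last exact: sqr_ge0.
    by rewrite mem_index_enum sqrf_eq0 => /(_ isT)/eqP.
  rewrite -(bc S v SF) big1 => [|tau _]; last by rewrite cv0 mulr0.
  by rewrite if_same mulr0.
have Gp : 0 < G by rewrite lt_neqAle eq_sym Gn0 mulr_ge0 ?sqrtr_ge0.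
(* This [l] turns [L + 8 l^2] with [L = lnn (2 * n)] into [9 l^2]. *)
set n := #|F| in ln0 F2 *; set l := Num.sqrt (lnn (2 * n)).
have n0 : (0 < n)%N by exact: ltnW.
have ln2n : 0 < lnn (2 * n).
  by apply: lt_le_trans ln0 _; apply: lnn_le; rewrite n0 leq_pmull.
have l0 : 0 < l by rewrite sqrtr_gt0.
have l2 : l ^+ 2 = lnn (2 * n) by rewrite sqr_sqrtr // ltW.
(* Setting [c] to zero off the extremal set [J] restricts the factorization to [J]. *)
have [|||x xE] := @bounded_signs R exp exp_addr exp_ge_1D V T 'I_n
  (fun i => b (enum_val i)) (fun v tau => if v \in J then c v tau else 0)
  G l (lnn (2 * n)) Gp l0.
- by move=> i; apply: b1; exact: enum_valP.
- move=> v; case: (v \in J) => //.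
  by rewrite big1 ?sqr_ge0 // => tau _; rewrite expr0n.
- by rewrite lnnK ?muln_gt0 // card_ord.
have [S SF SE] := JE [ffun v => ~~ x v].
have hl : l * (herdisc F)%:R <= l * (9 * G * l).
  apply: (@le_trans _ _ (G * (lnn (2 * n) + 8 * l ^+ 2))); last by rewrite -l2; lra.
  apply: le_trans (xE (enum_rank_in SF S)); rewrite ler_pM2l //.
  apply: (@le_trans _ _ (imbalance [ffun v => ~~ x v] (S :&: J))%:R).
    by rewrite ler_nat.
  rewrite imbalance_norm enum_rankK_in // le_eqVlt; apply/orP; left.
  apply/eqP; congr `|_|; apply: eq_bigr => v _; congr (_ * _).
  by case: (v \in J); rewrite ?bc // big1 // => tau _; rewrite mulr0.
rewrite ler_pM2l // in hl; apply: (le_trans hl).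
(* The last factor of the constant: [9 * 72 * 2 = 1296]. *)
have l2l : l <= 2 * Num.sqrt (lnn n).
  rewrite -(@ler_pXn2r _ 2) ?nnegrE ?mulr_ge0 ?sqrtr_ge0 // l2 exprMn sqr_sqrtr ?(ltW ln0) //.
  have := lnn_double F2; lra.
have := ler_wpM2l (ltW Gp) l2l; rewrite /G; lra.
Qed.
End UnionBound.

(* Specialization to the classical real numbers *)
From Stdlib Require Import Reals.
From mathcomp Require Import Rstruct.

Theorem theorem5p1 :
  exists C : R, (0 < C)%R /\
    forall (V : finType) (t : nat) (Fs : 'I_t -> {set {set V}}),
      (forall i, 2 <= #|Fs i|)%N ->
      let F := \bigcup_(i < t) Fs i in
      (INR (herdisc F) <=
        C * sqrt (ln (INR #|F|)) *
        sqrt (\big[Rplus/0%R]_(i < t) ((ln (INR #|Fs i|)) ^ 2 * (INR (herdisc (Fs i))) ^ 2)))%R.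
Proof.
exists (INR 1296); split; first by apply/RltP; rewrite INRE ltr0n.
move=> V t Fs Fs2 F; apply/RleP.
have exp1D x := introT RleP (exp_ineq1_le x).
have lnK n (n0 : leq 1 n) : exp (ln (INR n)) = INR n.
  by rewrite exp_ln //; apply/RltP; rewrite INRE ltr0n.
have lnE n n0 := etrans (lnK n n0) (INRE n).
have := @herdisc_union_le R exp (fun n => ln (INR n)) exp_plus exp1D lnE V t Fs Fs2.
rewrite -/F -!RsqrtE -!INRE => bound; apply: (le_trans bound).
rewrite le_eqVlt; apply/orP; left; apply/eqP.
apply: (congr1 (fun s => Rmult _ (sqrt s))).
by apply: eq_bigr => i _; rewrite !RpowE (INRE (herdisc _)).
Qed.
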